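(* Let $q$ be a prime power and $X\subseteq\mathbb{P}^2$ the Hermitian curve over $\mathbb{F}_{q^2}$. Fix integers $s,d$ with $2\le s\le d-1\le q-2$ and integers $a_1,\dots,a_s$ with $0<a_i\le d+1-i$ for all $i\in\{1,\dots,s\}$ and $a_1+\dots+a_s\le 3d-7+s$. Fix $s$ distinct collinear points $P_1,\dots,P_s\in X(\mathbb{F}_{q^2})$ and let $R$ be the line containing them. Set $B:=X(\mathbb{F}_{q^2})\setminus\{P_1,\dots,P_s\}$ and $E:=\sum_{i=1}^s a_iP_i$, and let $\mathcal{C}=\mathcal{C}(B,d,-E)$. Then $\mathcal{C}$ has length $n=q^3+1-s$ and dimension $k=\binom{d+2}{2}-\sum_{i=1}^s a_i$. The code $\mathcal{C}^\perp$ has minimum distance $d+2-s$, and its minimum-weight codewords are exactly those whose support consists of $d+2-s$ points of $B\cap R$. Every $S\subseteq R\cap B$ with $|S|=d+2-s$ is the support of exactly one (up to multiplication by a nonzero scalar) minimum-weight codeword.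
   Context: $\mathbb{P}^2$ is the projective plane over $\mathbb{F}_{q^2}$ with coordinates $(x:y:z)$; the Hermitian curve $X$ is the plane curve with affine equation $y+y^q=x^{q+1}$ (smooth, degree $q+1$, with $q^3+1$ rational points). $E$ is viewed both as a divisor on $X$ and as a zero-dimensional subscheme of $\mathbb{P}^2$. $\mathcal{C}(B,d,-E)$ denotes the code obtained by evaluating $H^0(X,\mathcal{O}_X(d)(-E))$ (degree-$d$ forms on $X$ vanishing on the scheme $E$) at the points of $B$, after fixing a coordinate representative of each point; coordinates are indexed by $B$. $\mathcal{C}^\perp$ is the dual code with respect to the standard dot product; weight = number of nonzero coordinates; support = set of points indexing nonzero coordinates; minimum distance = minimal weight of a nonzero codeword. *)

(* Defs.v *)
From HB Require Import structures.
From mathcomp Require Import all_boot all_order all_algebra all_field.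
From mathcomp Require Import mpoly.
From Stdlib Require Import ClassicalDescription.
Set Implicit Arguments. Unset Strict Implicit. Unset Printing Implicit Defensive.
Import Order.TTheory GRing.Theory.
Local Open Scope ring_scope.

Definition asb (A : Prop) : bool :=
  if excluded_middle_informative A then true else false.

(* Coordinates (x:y:z) of P^2 are indexed by 'I_3 : x = 0, y = 1, z = 2.   *)
Notation vec3 F := {ffun 'I_3 -> F^o}.

(* A point of P^2(F) is represented by its normalized representative:     *)
(* a nonzero vector whose first nonzero coordinate equals 1.               *)
Definition normalized {F : fieldType} (v : vec3 F) : bool :=
  [exists i : 'I_3, (v i == 1) && [forall j : 'I_3, (j < i)%N ==> (v j == 0)]].

Definition hermitian_poly (F : fieldType) (q : nat) : {mpoly F[3]} :=
  'X_(1 : 'I_3) * 'X_(2 : 'I_3) ^+ q + 'X_(1 : 'I_3) ^+ q * 'X_(2 : 'I_3)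
  - 'X_(0 : 'I_3) ^+ q.+1.

Definition hermitian_points (F : finFieldType) (q : nat) : {set vec3 F} :=
  [set v | normalized v & (hermitian_poly F q).@[v] == 0].

Definition line_points (F : finFieldType) (l : vec3 F) : {set vec3 F} :=
  [set v | normalized v & \sum_(i < 3) l i * v i == 0].

(* r lies in I_P^a, the a-th power of the homogeneous ideal I_P of the     *)
(* point P, i.e. in the ideal generated by products of a linear forms      *)
(* vanishing at P.                                                          *)
Definition in_point_ideal_pow (F : fieldType) (P : vec3 F) (a : nat)
    (r : {mpoly F[3]}) : Prop :=
  exists (N : nat) (c : 'I_N -> {mpoly F[3]}) (L : 'I_N -> 'I_a -> {mpoly F[3]}),
    (forall i j, L i j \is 1.-homog /\ (L i j).@[P] = 0) /\
    r = \sum_(i < N) c i * \prod_(j < a) L i j.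

(* The form f vanishes on the zero-dimensional subscheme a P of X (X the   *)
(* plane curve {G = 0}, P on X), seen as a subscheme of P^2: the germ of f *)
(* at P lies in the ideal ((G) + I_P^a) of O_{P^2,P}, i.e. h f lies in the *)
(* homogeneous ideal (G) + I_P^a for some homogeneous h with h(P) <> 0.    *)
Definition vanishes_on_multiple_point (F : fieldType) (G : {mpoly F[3]})
    (P : vec3 F) (a : nat) (f : {mpoly F[3]}) : Prop :=
  exists (e : nat) (h g r : {mpoly F[3]}),
    [/\ h \is e.-homog, h.@[P] != 0, in_point_ideal_pow P a r &
        h * f = g * G + r].

(* The set of codewords of C(B, d, -E), E = sum_i a_i P_i, on the curve    *)
(* {G = 0}: evaluations at (the representatives rep v of) the points v of  *)
(* B of the degree-d forms vanishing on E.  A word is a function on        *)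
(* vec3 F, and coordinates are indexed by B (words vanish outside B).      *)
Definition eval_code_set (F : finFieldType) (G : {mpoly F[3]}) (B : {set vec3 F})
    (rep : vec3 F -> vec3 F) (d s : nat) (P : 'I_s -> vec3 F) (a : 'I_s -> nat)
    : {set {ffun vec3 F -> F^o}} :=
  [set c : {ffun vec3 F -> F^o} | asb (exists f : {mpoly F[3]},
      [/\ f \is d.-homog,
          forall i, vanishes_on_multiple_point G (P i) (a i) f &
          forall v, c v = if v \in B then f.@[rep v] else 0])].

Definition eval_code (F : finFieldType) (G : {mpoly F[3]}) (B : {set vec3 F})
    (rep : vec3 F -> vec3 F) (d s : nat) (P : 'I_s -> vec3 F) (a : 'I_s -> nat)
    : {vspace {ffun vec3 F -> F^o}} :=
  <<enum (eval_code_set G B rep d P a)>>%VS.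

Definition supp (F : fieldType) (T : finType) (w : {ffun T -> F^o}) : {set T} :=
  [set v | w v != 0].
Definition weight (F : fieldType) (T : finType) (w : {ffun T -> F^o}) : nat :=
  #|supp w|.

Definition dual_code (F : finFieldType) (B : {set vec3 F})
    (C : {vspace {ffun vec3 F -> F^o}}) : {set {ffun vec3 F -> F^o}} :=
  [set w | (supp w \subset B) &&
           [forall c, (c \in C) ==> (\sum_(v in B) w v * c v == 0)]].

(* Main.v *)
Require Import Defs.
From HB Require Import structures.
From mathcomp Require Import all_boot all_order all_algebra all_field.
From mathcomp Require Import mpoly ring zify.
From Stdlib Require Import ClassicalDescription.
Import Order.TTheory GRing.Theory.
Set Implicit Arguments.
Unset Strict Implicit.
Unset Printing Implicit Defensive.
Local Open Scope ring_scope.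

(** The tangent to the Hermitian curve at a rational point P meets it only at P, with
    multiplicity q + 1; hence for a <= q + 1 the scheme a P of the curve is the scheme
    a P of its tangent line, and a form f vanishes on it iff t^a divides f(P + t U),
    where U is another point of the tangent. For the points P_i of the secant line R one
    can take for U the pole of R with respect to the Hermitian form, for all i at once.

    Independence of the conditions: dividing out R lowers the degree and all the a_i by
    one, so the scheme E imposes independent conditions on forms of degree d - 1 as soon
    as at most d - t of the a_i exceed t, for every t; this gives the dimension.

    Let w be a dual word with support S. No form of degree d vanishing on E vanishes on
    all points of S but one. The product of the s tangents vanishes on E and nowhere on B,
    so d - s further lines show |S| > d + 1 - s; if |S| = d + 2 - s, a line through two
    points of S and not through a third one would save a line, so S lies on a line L.
    If L is not R, then E being independent in degree d - 1 allows one to correct by a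
    multiple of L a form of degree d that separates a point of S from the others, a
    contradiction. Conversely, a form of degree d with d + 1 zeros on R vanishes on R,
    which produces a word supported on any d + 2 - s points of R and B; it is unique up
    to a scalar because a combination of two such words has a smaller support. *)

(** * Homogeneous forms and their restrictions to parametrized lines *)

Section Forms.
Variables (n : nat) (F : fieldType).
Implicit Types (f g : {mpoly F[n]}) (u v w : 'I_n -> F).

(** A form is a linear combination of monomials of its degree, and a monomial of positive degree is
    a variable times a monomial of lower degree. *)
Lemma dhomog_ind (Q : nat -> {mpoly F[n]} -> Prop) :
  Q 0%N 1 -> (forall d, Q d 0) ->
  (forall d c f g, Q d f -> Q d g -> Q d (c *: f + g)) ->
  (forall d i f, f \is d.-homog -> Q d f -> Q d.+1 ('X_i * f)) ->
  forall d f, f \is d.-homog -> Q d f.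
Proof.
move=> Q1 Q0 QD QX.
have Qm d m : mdeg m = d -> Q d 'X_[m].
  elim: d m => [|d IH] m dm.
    have /eqP-> : m == 0%MM by rewrite -mdeg_eq0 dm.
    by rewrite mpolyX0.
  have [i mi] : exists i, m i != 0%N.
    case: (pickP (fun i => m i != 0%N)) => [i mi|m0]; first by exists i.
    have : mdeg m = 0%N.
      by rewrite mdegE big1 // => i _; apply/eqP/negPn; rewrite m0.
    by rewrite dm.
  have le1 : (U_(i) <= m)%MM.
    apply/mnm_lepP => j; rewrite mnm1E; case: eqP => // <-.
    by rewrite lt0n.
  have dm' : mdeg (m - U_(i))%MM = d.
    apply/eqP; rewrite -(eqn_add2r 1) -{1}(mdeg1 i) -mdegD submK // dm.
    by rewrite addn1.
  rewrite -(submK le1) addmC mpolyXD; apply: QX; last exact: IH.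
  by rewrite dhomogX /= dm'.
move=> d f /dhomogP hf; rewrite (mpolyE f).
have: {subset msupp f <= msupp f} by [].
elim: {-2}(msupp f) => [|m ms IH] sub; first by rewrite big_nil.
rewrite big_cons; apply: QD.
  by apply: Qm; apply: hf; apply: sub; rewrite mem_head.
by apply: IH => x xm; apply: sub; rewrite in_cons xm orbT.
Qed.

Lemma dhomog_Xi i : ('X_i : {mpoly F[n]}) \is 1.-homog.
Proof. by rewrite dhomogX /= mdeg1. Qed.

Lemma meval_dhomog_scale d f (c : F) v : f \is d.-homog ->
  f.@[fun i => c * v i] = c ^+ d * f.@[v].
Proof.
move: d f; apply: dhomog_ind => [|d|d b f g Hf Hg|d i f _ Hf].
- by rewrite !meval1 mulr1.
- by rewrite !meval0 mulr0.
- by rewrite !mevalD !mevalZ Hf Hg; ring.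
- by rewrite !mevalM !mevalXU Hf exprS; ring.
Qed.

Definition dot u v : F := \sum_(i < n) u i * v i.
Definition linform u : {mpoly F[n]} := \sum_(i < n) u i *: 'X_i.

Lemma linform_homog u : linform u \is 1.-homog.
Proof. by apply: rpred_sum => i _; apply/rpredZ/dhomog_Xi. Qed.

Lemma meval_linform u v : (linform u).@[v] = dot u v.
Proof.
by rewrite /linform raddf_sum; apply: eq_bigr => i _ /=; rewrite mevalZ mevalXU.
Qed.

(* [restr u v f] is the polynomial f(u + t v) in t. *)
Definition restr u v : {mpoly F[n]} -> {poly F} :=
  mmap (@polyC F) (fun i => (u i)%:P + v i *: 'X).

HB.instance Definition _ u v := GRing.RMorphism.copy (restr u v)
  (mmap (@polyC F) (fun i => (u i)%:P + v i *: 'X)).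

Lemma restrZ u v c f : restr u v (c *: f) = c *: restr u v f.
Proof. by rewrite /restr mmapZ mul_polyC. Qed.

Lemma restrX u v i : restr u v 'X_i = (u i)%:P + v i *: 'X.
Proof. by rewrite /restr mmapX mmap1U. Qed.

Lemma restr_linform u v w :
  restr u v (linform w) = (dot w u)%:P + dot w v *: 'X.
Proof.
rewrite /linform raddf_sum /= /dot rmorph_sum scaler_suml -big_split /=.
apply: eq_bigr => i _; rewrite restrZ restrX scalerDr scalerA.
by rewrite polyCM mul_polyC.
Qed.

Lemma horner_restr u v f (t : F) : (restr u v f).[t] = f.@[fun i => u i + t * v i].
Proof.
rewrite (mpolyE f) !raddf_sum /= horner_sum; apply: eq_bigr => m _.
rewrite restrZ hornerZ mevalZ; congr (_ * _).
rewrite /restr mmapX mevalX /mmap1 horner_prod; apply: eq_bigr => i _.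
by rewrite horner_exp hornerD hornerC hornerZ hornerX mulrC.
Qed.

Lemma restr0 u v f : (restr u v f).[0] = f.@[u].
Proof. by rewrite horner_restr; apply: meval_eq => i; rewrite mul0r addr0. Qed.

(** The coefficient of t^d gives access to [v], the point at infinity of the line parametrized as u
    + t v. *)
Lemma coef_restr d f u v : f \is d.-homog ->
  (restr u v f)`_d = f.@[v] /\ (forall k, (d < k)%N -> (restr u v f)`_k = 0).
Proof.
move: d f; apply: dhomog_ind => [|d|d b f g [Hf1 Hf2] [Hg1 Hg2]|d i f _ [Hf1 Hf2]].
- by rewrite rmorph1 meval1 coef1; split=> // -[|k] //; rewrite coef1.
- by rewrite raddf0 meval0 coef0; split=> // k; rewrite coef0.
- rewrite raddfD /= restrZ; split; first by rewrite coefD coefZ Hf1 Hg1 mevalD mevalZ.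
  by move=> k ltk; rewrite coefD coefZ Hf2 // Hg2 // mulr0 addr0.
- rewrite rmorphM /= restrX; split.
    rewrite mulrDl coefD mul_polyC coefZ Hf2 // mulr0 add0r -scalerAl coefZ.
    by rewrite coefXM /= Hf1 mevalM mevalXU.
  case=> // k ltk; rewrite mulrDl coefD mul_polyC coefZ Hf2 1?(ltn_trans _ ltk) //.
  by rewrite -scalerAl coefZ coefXM /= Hf2 // !mulr0 addr0.
Qed.

Lemma size_restr d f u v : f \is d.-homog -> (size (restr u v f) <= d.+1)%N.
Proof.
by move=> hf; apply/leq_sizeP => k dk; apply: (coef_restr u v hf).2.
Qed.

Lemma dhomog_prod_linear (I : Type) (s : seq I) (f_ : I -> {mpoly F[n]}) :
  (forall i, f_ i \is 1.-homog) -> \prod_(i <- s) f_ i \is (size s).-homog.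
Proof.
move=> hf; elim: s => [|i s IH]; first by rewrite big_nil dhomog1.
by rewrite big_cons -[size _]add1n; apply: dhomogM.
Qed.

End Forms.

(** * Division of forms in a frame at a point, and contact with a tangent line *)

Lemma coprimep_Xn (F : fieldType) (p : {poly F}) a : p.[0] != 0 -> coprimep ('X^a) p.
Proof.
by move=> p0; apply: coprimep_expl; rewrite coprimep_sym coprimepX.
Qed.

Lemma dvdX (F : fieldType) (p : {poly F}) : ('X %| p) = (p.[0] == 0).
Proof. by rewrite -[X in X %| p]subr0 -polyC0 dvdp_XsubCl /root. Qed.

(* [pred_homog d g]: g is homogeneous of degree d - 1, which forces g = 0 when
   d = 0. *)
Definition pred_homog (F : fieldType) d (g : {mpoly F[3]}) := if d is e.+1 then g \is e.-homog else g == 0.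

Section Division.
Variables (F : fieldType) (P U V : 'I_3 -> F) (A B T : {mpoly F[3]}).
Hypotheses (A1 : A \is 1.-homog) (B1 : B \is 1.-homog).
(** [A], [B], [T] are the coordinates in the frame [P], [U], [V]; the line through [P] and [U] is
    given by T = 0. *)
Hypothesis coordE : forall i, 'X_i = P i *: A + U i *: B + V i *: T.

Let pred_homog0 d : pred_homog d (0 : {mpoly F[3]}).
Proof. by case: d => /=; rewrite ?eqxx // => d; apply: dhomog0. Qed.

Let pred_homogD d c (f g : {mpoly F[3]}) : pred_homog d f -> pred_homog d g -> pred_homog d (c *: f + g).
Proof.
case: d => [/eqP-> /eqP->|d hf hg] /=; first by rewrite scaler0 addr0.
by apply: rpredD => //; apply: rpredZ.
Qed.

Let pred_homogM d (f g : {mpoly F[3]}) :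
  f \is 1.-homog -> pred_homog d g -> pred_homog d.+1 (f * g).
Proof.
case: d => [_ /eqP->|d hf hg] /=; first by rewrite mulr0 dhomog0.
by rewrite -[d.+1]add1n; apply: dhomogM.
Qed.

Let homog_pred d (g : {mpoly F[3]}) : pred_homog d g -> g \is d.-1.-homog.
Proof. by case: d => // /eqP->; apply: dhomog0. Qed.

(** Modulo [T] and [B] only powers of [A] survive, with the value at [P] as coefficient. *)
Let dhomog_divide d f : f \is d.-homog -> exists g1 g2,
  [/\ pred_homog d g1, pred_homog d g2 & f = T * g1 + B * g2 + f.@[P] *: A ^+ d].
Proof.
move: d f; apply: dhomog_ind.
- exists 0, 0; split=> /=; rewrite ?eqxx //.
  by rewrite !mulr0 !add0r meval1 expr0 scale1r.
- by move=> d; exists 0, 0; split=> //; rewrite meval0 !mulr0 scale0r !add0r.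
- move=> d c f g [f1 [f2 [hf1 hf2 ef]]] [g1 [g2 [hg1 hg2 eg]]].
  exists (c *: f1 + g1), (c *: f2 + g2); split; try exact: pred_homogD.
  rewrite {1}ef {1}eg mevalD mevalZ scalerDl -!mul_mpolyC mpolyCM; ring.
- move=> d i f hf [f1 [f2 [hf1 hf2 ef]]].
  have hA : A ^+ d \is d.-homog by rewrite -[X in X.-homog]mul1n; apply: dhomogMn.
  exists ((V i * f.@[P]) *: A ^+ d + 'X_i * f1), ((U i * f.@[P]) *: A ^+ d + 'X_i * f2).
  split; try by apply: pred_homogD => //; apply: pred_homogM => //; apply: dhomog_Xi.
  rewrite {1}ef mevalM mevalXU coordE exprS.
  rewrite -!mul_mpolyC !mpolyCM; ring.
Qed.

Hypotheses (restrB : restr P U B = 'X) (restrT : restr P U T = 0).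

(** Restriction to the line kills T g1 and leaves t times the restriction of g2, so g2 vanishes on
    the line as well, in lower degree. *)
Lemma dhomog_divide_restr0 d f : f \is d.-homog -> restr P U f = 0 ->
  exists2 g, pred_homog d g & f = T * g.
Proof.
elim: d f => [|d IH] f hf f0; have [g1 [g2 [hg1 hg2 ef]]] := dhomog_divide hf.
  exists g1 => //; rewrite ef (eqP hg2) -(restr0 P U) f0 horner0 scale0r mulr0.
  by rewrite !addr0.
rewrite -(restr0 P U) f0 horner0 scale0r addr0 in ef.
have [|g hg eg] := IH _ hg2.
  move/eqP: f0; rewrite ef raddfD /= !rmorphM /= restrB restrT mul0r add0r.
  by rewrite mulf_eq0 polyX_eq0 => /eqP.
exists (1 *: g1 + B * g); first by apply: pred_homogD => //; apply: pred_homogM.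
by rewrite ef eg scale1r; ring.
Qed.

(** Each division strips one factor t from the restriction and splits one factor [B] off the
    remainder. *)
Let dhomog_divide_pow k d f : f \is d.-homog -> 'X^k %| restr P U f -> exists g1 g2,
  pred_homog d g1 /\ f = T * g1 + B ^+ k * g2.
Proof.
elim: k d f => [|k IH] d f hf dv.
  by exists 0, f; split=> //; rewrite mulr0 add0r expr0 mul1r.
have [g1 [g2 [hg1 hg2 ef]]] := dhomog_divide hf.
have fP : f.@[P] = 0.
  rewrite -(restr0 P U); apply/eqP; rewrite -dvdX; apply: dvdp_trans dv.
  by rewrite exprS dvdp_mulr.
rewrite fP scale0r addr0 in ef.
have dv2 : 'X^k %| restr P U g2.
  move: dv; rewrite ef raddfD /= !rmorphM /= restrB restrT mul0r add0r exprS.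
  by rewrite dvdp_mul2l ?polyX_eq0.
case: d hf hg1 hg2 => [|d] hf hg1 hg2.
  by exists g1, 0; split=> //; rewrite ef (eqP hg2) !mulr0.
have [h1 [h2 [hh1 eg2]]] := IH _ _ hg2 dv2.
exists (1 *: g1 + B * h1), h2; split.
  by apply: pred_homogD => //; apply: pred_homogM.
by rewrite {1}ef {1}eg2 scale1r exprS; ring.
Qed.

Lemma dhomog_divide_restr_pow k d f : f \is d.-homog -> 'X^k %| restr P U f -> exists g1 g2,
  g1 \is d.-1.-homog /\ f = T * g1 + B ^+ k * g2.
Proof.
move=> hf /(dhomog_divide_pow hf) [g1 [g2 [h1 ef]]].
by exists g1, g2; split=> //; apply: homog_pred.
Qed.

Hypotheses (restrVB : restr P V B = 0) (restrVT : restr P V T = 'X).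

(** Forward: restricted to the line, [G] and products of [a] linear forms vanishing at [P] are
    divisible by t^a, and h is a unit at t = 0. Backward: write G = T h + B^(q+1) g2 and f = T f1 +
    B^a f2; then h f - f1 G is divisible by B^a. *)
Lemma vanishes_on_multiple_pointP (G : {mpoly F[3]}) (q a d : nat) (p : vec3 F) (f : {mpoly F[3]}) :
  p =1 P -> G \is q.+1.-homog -> 'X^(q.+1) %| restr P U G -> (restr P V G)`_1 != 0 ->
  (a <= q.+1)%N -> f \is d.-homog ->
  vanishes_on_multiple_point G p a f <-> 'X^a %| restr P U f.
Proof.
move=> eP hG dG nG aq hf; split.
  case=> e [h [g [r [hh hp [N [c [L [HL er]]]] ehf]]]].
  have hP : (restr P U h).[0] != 0 by rewrite restr0 -(meval_eq h eP).
  rewrite -(Gauss_dvdpr _ (coprimep_Xn a hP)) -rmorphM ehf raddfD /= rmorphM /=.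
  apply: dvdp_add; first by rewrite dvdp_mull //; apply: dvdp_trans dG; rewrite dvdp_exp2l.
  rewrite er raddf_sum /=; apply: (big_ind (fun x => 'X^a %| x)) => [|x y hx hy|i _].
  - exact: dvdp0.
  - exact: dvdp_add.
  rewrite rmorphM rmorph_prod /= dvdp_mull //.
  have -> : 'X^a = \prod_(j < a) ('X : {poly F}) by rewrite prodr_const card_ord.
  apply: (big_ind2 (fun x y => x %| y)) => // [x1 x2 y1 y2|j _]; first exact: dvdp_mul.
  by rewrite dvdX restr0 -(meval_eq _ eP) (HL i j).2.
move=> df.
have [h [g2 [hh eG]]] := dhomog_divide_restr_pow hG dG.
have [f1 [f2 [_ ef]]] := dhomog_divide_restr_pow hf df.
(* On P + t V the form [B] vanishes and [T] is t, so h(P) is the linear coefficient of [G] there,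
   which is nonzero by smoothness at [P]. *)
have hP : h.@[P] != 0.
  move: nG; rewrite eG raddfD /= !rmorphM /= rmorphXn /= restrVB restrVT.
  by rewrite expr0n /= mul0r addr0 coefXM /= -horner_coef0 restr0.
exists q, h, f1, (B ^+ a * (h * f2 - f1 * B ^+ (q.+1 - a) * g2)); split=> //.
- by rewrite (meval_eq h eP).
- exists 1%N, (fun=> h * f2 - f1 * B ^+ (q.+1 - a) * g2), (fun _ _ => B).
  split; last by rewrite big_ord1 prodr_const card_ord mulrC.
  by move=> _ _; split=> //; rewrite (meval_eq _ eP) -(restr0 P U) restrB hornerX.
- have eB : B ^+ q.+1 = B ^+ a * B ^+ (q.+1 - a) by rewrite -exprD subnKC.
  by rewrite {1}ef eG eB; ring.
Qed.

End Division.

(** * Linear algebra of the plane, and forms separating points *)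

Lemma ord3P (Q : 'I_3 -> Prop) : Q 0 -> Q 1 -> Q 2 -> forall i, Q i.
Proof.
move=> Q0 Q1 Q2 [[|[|[|//]]] lti].
- by rewrite (_ : Ordinal _ = 0) //; apply: val_inj.
- by rewrite (_ : Ordinal _ = 1) //; apply: val_inj.
- by rewrite (_ : Ordinal _ = 2) //; apply: val_inj.
Qed.

Lemma sum_ord3 (V : nmodType) (E : 'I_3 -> V) : \sum_(i < 3) E i = E 0 + E 1 + E 2.
Proof.
rewrite !big_ord_recl big_ord0 addr0 addrA.
by congr (E _ + E _ + E _); apply: val_inj.
Qed.

Section Plane.
Variable F : fieldType.
Implicit Types (u v w : 'I_3 -> F).

Definition mk3 (x y z : F) (i : 'I_3) : F := nth 0 [:: x; y; z] i.

Definition par u v := forall i j, u i * v j = u j * v i.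

Definition cross u v := mk3 (u 1 * v 2 - u 2 * v 1) (u 2 * v 0 - u 0 * v 2)
  (u 0 * v 1 - u 1 * v 0).

Lemma cross_par u v w : dot u w = 0 -> dot v w = 0 -> par w (cross u v).
Proof.
rewrite /dot !sum_ord3 => uw vw.
have [/eqP e0 [/eqP e1 /eqP e2]] : w 1 * cross u v 2 - w 2 * cross u v 1 = 0 /\
           w 2 * cross u v 0 - w 0 * cross u v 2 = 0 /\
           w 0 * cross u v 1 - w 1 * cross u v 0 = 0.
  (* The double cross product of w with the cross product of u and v, in expanded form. *)
  pose c k := u k * (v 0 * w 0 + v 1 * w 1 + v 2 * w 2)
              - v k * (u 0 * w 0 + u 1 * w 1 + u 2 * w 2).
  have c0 k' : c k' = 0 by rewrite /c uw vw !mulr0 subr0.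
  rewrite -{1}(c0 0) -{1}(c0 1) -{1}(c0 2) /c /cross /mk3 /=.
  by split; [|split]; ring.
move: e0 e1 e2; rewrite !subr_eq0 => /eqP e0 /eqP e1 /eqP e2.
by apply: ord3P; apply: ord3P => //; rewrite ?e0 ?e1 ?e2.
Qed.

Lemma par_cross0 u v : cross u v =1 (fun=> 0) -> par u v.
Proof.
move=> c0; have e i := c0 i.
move: (e 0) (e 1) (e 2); rewrite /cross /mk3 /= => /eqP e0 /eqP e1 /eqP e2.
move: e0 e1 e2; rewrite !subr_eq0 => /eqP e0 /eqP e1 /eqP e2.
by apply: ord3P; apply: ord3P => //; rewrite ?e0 ?e1 ?e2 // mulrC.
Qed.

Lemma dot_crossl u v : dot (cross u v) u = 0.
Proof. by rewrite /dot sum_ord3 /cross /mk3 /=; ring. Qed.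

Lemma dot_crossr u v : dot (cross u v) v = 0.
Proof. by rewrite /dot sum_ord3 /cross /mk3 /=; ring. Qed.

(** Being parallel is transitive only through a nonzero vector; the factor [w k] accounts for w =
    0. *)
Lemma par_mul0 u v w : par u w -> par v w ->
  forall i j k, (u i * v j - u j * v i) * w k = 0.
Proof.
move=> pu pv i j k; rewrite mulrBl -!mulrA (pv j k) (pv i k) !mulrA.
rewrite ![_ * v k]mulrC -!mulrA -mulrBr.
by rewrite (pu i j) subrr mulr0.
Qed.

(* Evaluating at [pt v] instead of [v] keeps scalars in [F] rather than in the
   regular module [F^o]. *)
Definition pt (v : vec3 F) : 'I_3 -> F := v.

Lemma normalizedP (v : vec3 F) : normalized v -> exists2 i : 'I_3,
  pt v i = 1 & forall j : 'I_3, (j < i)%N -> pt v j = 0.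
Proof.
move=> /existsP[i /andP[/eqP vi /forallP Hj]]; exists i => // j ji.
by move: (Hj j); rewrite ji => /eqP.
Qed.

Lemma normalized_par (u v : vec3 F) : normalized u -> normalized v ->
  par (pt u) (pt v) -> u = v.
Proof.
move=> /normalizedP[i ui Hi] /normalizedP[j vj Hj] uv.
have eij : i = j.
  have uvij := uv i j.
  have /eqP := oner_neq0 F; case: (ltngtP i j) => [/Hj vi0|/Hi uj0|/val_inj //] [].
    by rewrite -(mulr1 1) -{1}ui -vj uvij vi0 mulr0.
  by rewrite -(mulr1 1) -{1}ui -vj uvij uj0 mul0r.
apply/ffunP => k; rewrite -{j}eij in vj Hj.
by have := uv k i; rewrite vj ui mulr1 mul1r.
Qed.

Lemma basis3 u v w :
  (forall a b c, (forall i, a * u i + b * v i + c * w i = 0) -> [/\ a = 0, b = 0 & c = 0]) ->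
  forall x : 'I_3 -> F, exists a b c, forall i, x i = a * u i + b * v i + c * w i.
Proof.
move=> free x; pose M := \matrix_(k < 3, i < 3) mk3 (u i) (v i) (w i) k.
have mulME (y : 'rV[F]_3) i :
    (y *m M) 0 i = y 0 0 * u i + y 0 1 * v i + y 0 2 * w i.
  by rewrite mxE sum_ord3 !mxE /mk3.
have Mu : row_free M.
  apply: inj_row_free => y yM.
  case: (free (y 0 0) (y 0 1) (y 0 2)) => [i|y0 y1 y2].
    by rewrite -mulME yM mxE.
  by apply/matrixP => i; rewrite (ord1 i) => {i}; apply: ord3P; rewrite mxE.
pose y := (\row_i x i) *m invmx M.
exists (y 0 0), (y 0 1), (y 0 2) => i.
by rewrite -mulME mulmxKV ?mxE // -row_free_unit.
Qed.

Lemma separating_line (u v : vec3 F) : normalized u -> normalized v -> u != v ->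
  exists f : {mpoly F[3]}, [/\ f \is 1.-homog, f.@[pt u] != 0 & f.@[pt v] = 0].
Proof.
move=> nu nv uv.
have [i [j ne]] : exists i j, pt u i * pt v j != pt u j * pt v i.
  case: (pickP (fun ij : 'I_3 * 'I_3 => pt u ij.1 * pt v ij.2 != pt u ij.2 * pt v ij.1)).
    by case=> i j; exists i, j.
  move=> H; case/eqP: uv; apply: normalized_par => // i j.
  by apply/eqP/negPn; rewrite (H (i, j)).
exists (pt v j *: 'X_i - pt v i *: 'X_j); split.
- by apply: rpredB; apply/rpredZ/dhomog_Xi.
- by rewrite mevalB !mevalZ !mevalXU subr_eq0 mulrC [X in _ != X]mulrC.
- by rewrite mevalB !mevalZ !mevalXU mulrC subrr.
Qed.

(** A product of lines, each through one point of [vs] and missing [u], padded to degree [e] by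
    powers of a variable equal to 1 at [u]. *)
Lemma separating_form (u : vec3 F) (vs : seq (vec3 F)) e :
  normalized u -> (forall v : vec3 F, v \in vs -> normalized v /\ u != v) -> (size vs <= e)%N ->
  exists f : {mpoly F[3]}, [/\ f \is e.-homog, f.@[pt u] != 0 &
    forall v : vec3 F, v \in vs -> f.@[pt v] = 0].
Proof.
move=> nu; elim: vs e => [|v vs IH] e Hvs.
  move=> _; have [i ui _] := normalizedP nu.
  exists ('X_i ^+ e); split=> //.
    by rewrite -[X in X.-homog]mul1n; apply/dhomogMn/dhomog_Xi.
  by rewrite rmorphXn /= mevalXU ui expr1n oner_eq0.
case: e => // e /= le_e.
have [|f [hf fu fv]] := IH e _ le_e.
  by move=> w wv; apply: Hvs; rewrite in_cons wv orbT.
have [nv uv] := Hvs _ (mem_head _ _).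
have [g [hg gu gv]] := separating_line nu nv uv.
exists (g * f); split.
- by rewrite -[e.+1]add1n; apply: dhomogM.
- by rewrite mevalM mulf_neq0.
- move=> w; rewrite in_cons => /orP[/eqP->|/fv w0]; rewrite mevalM ?gv ?mul0r //.
  by rewrite w0 mulr0.
Qed.

End Plane.

(** * The Hermitian form and the equation of the curve *)

Section HermitianForm.
Variables (F : fieldType) (q : nat).
Hypotheses (q_gt1 : (1 < q)%N) (q_char : [pchar F].-nat q).
Hypothesis q2K : forall x : F, (x ^+ q) ^+ q = x.
Implicit Types (u v w : 'I_3 -> F).

(* The coefficients of the linear form herm _ v, which defines the polar line of v. *)
Definition polar v := mk3 (- v 0 ^+ q) (v 2 ^+ q) (v 1 ^+ q).

(* The sesquilinear form polarizing the equation of the Hermitian curve. *)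
Definition herm u v := dot (polar v) u.

Lemma hermE u v : herm u v = u 1 * v 2 ^+ q + u 2 * v 1 ^+ q - u 0 * v 0 ^+ q.
Proof. by rewrite /herm /dot sum_ord3 /polar /mk3 /=; ring. Qed.

Lemma meval_hermitian v : (hermitian_poly F q).@[v] = herm v v.
Proof.
rewrite hermE /hermitian_poly mevalB mevalD !mevalM !rmorphXn /= !mevalXU exprS.
by ring.
Qed.

Lemma hermitian_homog : hermitian_poly F q \is q.+1.-homog.
Proof.
have hX i k : ('X_i ^+ k : {mpoly F[3]}) \is k.-homog.
  by rewrite -[X in X.-homog]mul1n; apply/dhomogMn/dhomog_Xi.
apply: rpredB; last exact: hX.
apply: rpredD; first by rewrite -[q.+1]add1n; apply/dhomogM/hX/dhomog_Xi.
by rewrite -[q.+1]addn1; apply/dhomogM/dhomog_Xi/hX.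
Qed.

Let frobD (x y : F) : (x + y) ^+ q = x ^+ q + y ^+ q.
Proof. exact: exprDn_pchar. Qed.

Let frobN (x : F) : (- x) ^+ q = - x ^+ q.
Proof. by apply/eqP; rewrite -subr_eq0 opprK -frobD addNr expr0n gtn_eqF // ltnW. Qed.

Lemma herm_sym u v : herm v u = herm u v ^+ q.
Proof. by rewrite !hermE !frobD frobN !exprMn !q2K; ring. Qed.

Lemma herm_comb a b c u v w x :
  herm (fun i => a * u i + b * v i + c * w i) x = a * herm u x + b * herm v x + c * herm w x.
Proof. by rewrite !hermE; ring. Qed.

(** Both vectors are orthogonal to each other and to themselves, hence parallel to the cross product
    of their polars. The coordinates of this product are, up to sign and order, the q-th powers of
    the minors of u and v, so each minor x satisfies x^(q+1) = 0. *)
Lemma herm_isotropic_par u v : herm u u = 0 -> herm v v = 0 -> herm u v = 0 -> par u v.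
Proof.
move=> uu vv uv.
have vu : herm v u = 0 by rewrite herm_sym uv expr0n gtn_eqF // ltnW.
pose n := cross (polar u) (polar v).
have P3 := par_mul0 (cross_par uu uv : par u n) (cross_par vu vv : par v n).
have frobB (x y : F) : (x - y) ^+ q = x ^+ q - y ^+ q by rewrite frobD frobN.
have mul_frob0 (x : F) : x * x ^+ q = 0 -> x = 0.
  by move/eqP; rewrite -exprS expf_eq0 /= => /eqP.
apply: par_cross0; apply: ord3P; apply: mul_frob0; rewrite /cross /mk3 /=.
- rewrite -[RHS](P3 2 1 0) /n /cross /polar /mk3 /=.
  rewrite frobB !exprMn; ring.
- rewrite -[RHS](P3 2 0 2) /n /cross /polar /mk3 /=.
  rewrite frobB !exprMn; ring.
- rewrite -[RHS](P3 0 1 1) /n /cross /polar /mk3 /=.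
  rewrite frobB !exprMn; ring.
Qed.

(** For u on the curve and v on the tangent at u, only the term in t^(q+1) survives. *)
Lemma restr_hermitian u v : restr u v (hermitian_poly F q) =
  (herm u u)%:P + herm v u *: 'X + herm u v *: 'X^q + herm v v *: 'X^(q.+1).
Proof.
have frobP (x y : F) : (x%:P + y *: 'X) ^+ q = (x ^+ q)%:P + (y ^+ q) *: 'X^q :> {poly F}.
  rewrite exprDn_pchar; first by rewrite exprZn polyC_exp.
  by apply: sub_in_pnat q_char => p _; rewrite pchar_poly.
rewrite /hermitian_poly raddfB raddfD /= !rmorphM /= !rmorphXn /= !restrX.
rewrite !hermE !(exprS _ q) !frobP -!mul_polyC.
rewrite !(polyCM, polyCD, polyCN); ring.
Qed.

End HermitianForm.

(** * Interpolation of jets at collinear points *)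

Section Jets.
Variables (F : fieldType) (s : nat) (P : 'I_s -> vec3 F) (l U : 'I_3 -> F).
Hypotheses (P_norm : forall i, normalized (P i)) (P_inj : injective P).
Hypotheses (lP : forall i, dot l (pt (P i)) = 0) (lU : dot l U != 0).

Lemma interpolation (I : {set 'I_s}) e (y : 'I_s -> F) : (#|I| <= e.+1)%N ->
  exists2 f : {mpoly F[3]}, f \is e.-homog & forall i, i \in I -> f.@[pt (P i)] = y i.
Proof.
move=> cI.
have /fin_all_exists[L HL] (i : 'I_s) : exists f : {mpoly F[3]}, i \in I ->
    [/\ f \is e.-homog, f.@[pt (P i)] != 0 & forall j, j \in I -> j != i -> f.@[pt (P j)] = 0].
  have [iI|_] := boolP (i \in I); last by exists 0.
  pose vs := [seq P j | j <- enum (I :\ i)].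
  have [||f [hf fi fj]] := @separating_form F (P i) vs e (P_norm i).
  - move=> _ /mapP[j + ->]; rewrite mem_enum !inE => /andP[ji _]; split=> //.
    by rewrite (inj_eq P_inj) eq_sym.
  - by rewrite size_map -cardE; move: cI; rewrite (cardsD1 i) iI.
  exists f => _; split=> // j jI ji; apply: fj; apply: map_f.
  by rewrite mem_enum !inE ji.
exists (\sum_(i in I) (y i / (L i).@[pt (P i)]) *: L i).
  by apply: rpred_sum => i iI; apply: rpredZ; case: (HL i iI).
move=> i iI; rewrite raddf_sum /= (bigD1 i) //= mevalZ mulfVK; last by case: (HL i iI).
rewrite big1 ?addr0 // => j /andP[jI ji].
have [_ _ Lj] := HL j jI; rewrite mevalZ (Lj i) ?mulr0 //.
by rewrite eq_sym.
Qed.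

(* Peeling off the line l lowers the degree and every order of contact by one. *)
Lemma jet_interpolation e (a : 'I_s -> nat) (c : 'I_s -> {poly F}) :
  (forall t, #|[set i | (t < a i)%N]| <= e.+1 - t)%N ->
  exists2 f : {mpoly F[3]}, f \is e.-homog &
    forall i, 'X^(a i) %| c i - restr (pt (P i)) U f.
Proof.
elim: e a c => [|e IH] a c Ha.
all: have [f0 hf0 ef0] := interpolation (fun i => (c i).[0]) (leq_trans (Ha 0%N) (leq_subr _ _)).
all: have X_dvd i : (0 < a i)%N -> 'X %| c i - restr (pt (P i)) U f0
  by move=> ai; rewrite dvdX hornerD hornerN restr0 ef0 ?inE // subrr.
  (* In degree 0 the hypothesis at t = 1 says that no [a i] exceeds 1. *)
  exists f0 => // i; have := X_dvd i; case E : (a i) => [|[|k]] dv.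
  - by rewrite expr0 dvd1p.
  - by rewrite expr1 dv.
  have := Ha 1%N; rewrite subnn leqn0 cards_eq0 => /eqP/setP/(_ i).
  by rewrite !inE E.
(* Since [l] restricts to t l(U) at every [P i], the cofactor of [l] has to interpolate the
   remainder divided by t l(U). *)
pose r i := (c i - restr (pt (P i)) U f0) %/ 'X.
have [|g hg Hg] := IH (fun i => (a i).-1) (fun i => (dot l U)^-1 *: r i).
  move=> t; apply: leq_trans (Ha t.+1); apply: subset_leq_card.
  by apply/subsetP => i; rewrite !inE; case: (a i).
exists (f0 + linform l * g).
  by apply: rpredD => //; rewrite -[e.+1]add1n; apply/dhomogM/hg/linform_homog.
move=> i; have := X_dvd i; have := Hg i; case E : (a i) => [|k] dv dv0.
  by rewrite expr0 dvd1p.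
rewrite raddfD /= rmorphM /= restr_linform lP add0r opprD addrA.
rewrite -[X in X - _](divpK (dv0 isT)) -/(r i) exprS.
have -> : r i * 'X - dot l U *: 'X * restr (pt (P i)) U g =
    'X * (dot l U *: ((dot l U)^-1 *: r i - restr (pt (P i)) U g)).
  by rewrite scalerBr scalerA mulfV // scale1r mulrBr -scalerAl -scalerAr mulrC.
by rewrite dvdp_mul2l ?polyX_eq0 // dvdpZr.
Qed.

End Jets.

(** * Rational points of the Hermitian curve, and forms vanishing at all of them *)

Lemma dhomog_vanish_lines (F : fieldType) d (f : {mpoly F[3]}) (xs : seq F) :
  f \is d.-homog -> uniq xs -> (d < size xs)%N ->
  (forall x, x \in xs -> restr (mk3 x 0 1) (mk3 0 1 0) f = 0) -> f = 0.
Proof.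
elim: d f xs => [|d IH] f [|x xs] // hf /= /andP[xxs uxs] sz f0.
all: have coordE i : 'X_i = mk3 x 0 1 i *: 'X_2 + mk3 0 1 0 i *: 'X_1
    + mk3 1 0 0 i *: ('X_0 - x *: 'X_2) :> {mpoly F[3]}
  by move: i; apply: ord3P; rewrite /mk3 /= ?scale0r ?scale1r; ring.
all: have hT : 'X_0 - x *: 'X_2 \is @ishomog1 3 F 1 mdeg
  by apply: rpredB; [|apply: rpredZ]; apply: dhomog_Xi.
all: have restrB : restr (mk3 x 0 1) (mk3 0 1 0) 'X_1 = 'X
  by rewrite restrX /mk3 /= scale1r polyC0 add0r.
all: have restrT : restr (mk3 x 0 1) (mk3 0 1 0) ('X_0 - x *: 'X_2) = 0
  by rewrite raddfB /= restrZ !restrX /mk3 /= !scale0r !addr0 alg_polyC subrr.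
all: have [g hg ef] := dhomog_divide_restr0 (@dhomog_Xi 3 F 2) (@dhomog_Xi 3 F 1)
   coordE restrB restrT hf (f0 x (mem_head _ _)).
  by rewrite ef (eqP hg) mulr0.
(* On another line of the pencil the factor split off is a nonzero constant, so the cofactor
   vanishes there. *)
rewrite ef (IH g xs) ?mulr0 // => y yxs.
have := f0 y; rewrite in_cons yxs orbT => /(_ isT).
rewrite ef rmorphM raddfB /= restrZ !restrX /mk3 /= !scale0r !addr0 alg_polyC -polyCB.
move/eqP; rewrite mulf_eq0 polyC_eq0 subr_eq0 => /orP[/eqP yx|/eqP //].
by rewrite -yx yxs in xxs.
Qed.

Lemma normalize_exists (F : fieldType) (v : 'I_3 -> F) i0 : v i0 != 0 ->
  exists c : F, exists2 u : vec3 F, normalized u & c != 0 /\ forall i, v i = c * pt u i.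
Proof.
move=> vi0; case: (@arg_minnP _ i0 (fun i => v i != 0) val vi0) => i vi mini.
exists (v i), [ffun k => v k / v i]; last first.
  by split=> // k; rewrite /pt ffunE mulrC divfK.
apply/existsP; exists i; rewrite ffunE mulfV // eqxx; apply/forallP => j.
apply/implyP => ji; rewrite ffunE; have [->|vj] := eqVneq (v j) 0; first by rewrite mul0r.
by have := mini j vj; rewrite leqNgt ji.
Qed.

Lemma herm_scale (F : fieldType) q c (u v : 'I_3 -> F) : (forall i, v i = c * u i) ->
  herm q v v = c * c ^+ q * herm q u u.
Proof. by move=> vE; rewrite !hermE !vE !exprMn; ring. Qed.

Section HermitianCurve.
Variables (F : finFieldType) (q : nat).
Hypothesis q_pp : exists p k : nat, [/\ prime p, (0 < k)%N & q = (p ^ k)%N].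
Hypothesis cardF : #|F| = (q ^ 2)%N.

Lemma prime_power_gt1 : (1 < q)%N.
Proof.
case: q_pp => p [k [p_pr k_gt0 ->]].
by rewrite -(exp1n k) ltn_exp2r // prime_gt1.
Qed.

Lemma prime_power_pchar : [pchar F].-nat q.
Proof.
case: q_pp => p [k [p_pr k_gt0 eq]].
have pF : p \in [pchar F] by apply: (card_finPcharP _ p_pr (n := k * 2)); rewrite cardF eq expnM.
by rewrite eq pnatX pnatE // pF.
Qed.

Lemma frob2K (x : F) : (x ^+ q) ^+ q = x.
Proof. by rewrite -exprM -[(q * q)%N]/(q ^ 2)%N -cardF expf_card. Qed.

Let q_gt1 := prime_power_gt1.
Let q_char := prime_power_pchar.

(** The map y -> y^q + y sends the q^2 elements of the field to elements fixed by x -> x^q. There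
    are at most q of these, and each fibre has at most q elements, so equality holds throughout. *)
Lemma trace_fiber (c : F) : c ^+ q = c -> #|[set y : F | y ^+ q + y == c]| = q.
Proof.
move=> cq; pose fib (c : F) := [set y : F | y ^+ q + y == c].
have card_roots (p : {poly F}) (A : {set F}) : p != 0 -> (size p <= q.+1)%N ->
    {in A, forall x, root p x} -> (#|A| <= q)%N.
  move=> p0 sp Ap; rewrite -ltnS; apply: leq_trans sp; rewrite cardE.
  apply: max_poly_roots => //; last exact: enum_uniq.
  by apply/allP => x; rewrite mem_enum; apply: Ap.
have sXq : size ('X^q : {poly F}) = q.+1 by rewrite size_polyXn.
have nzsz (p : {poly F}) : size p = q.+1 -> p != 0.
  by move=> sp; rewrite -size_poly_eq0 sp.
have fib_le c' : (#|fib c'| <= q)%N.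
  have sp : size ('X^q + ('X - c'%:P) : {poly F}) = q.+1.
    by rewrite size_polyDl sXq // size_XsubC ltnS.
  apply: (card_roots _ _ (nzsz _ sp)); first by rewrite sp.
  move=> x; rewrite inE => /eqP ex.
  by rewrite /root hornerD hornerXn hornerXsubC addrA ex subrr.
pose K := [set c : F | c ^+ q == c].
have K_le : (#|K| <= q)%N.
  have sp : size ('X^q - 'X : {poly F}) = q.+1.
    by rewrite size_polyDl sXq // size_polyN size_polyX ltnS.
  apply: (card_roots _ _ (nzsz _ sp)); first by rewrite sp.
  by move=> x; rewrite inE => /eqP ex; rewrite /root !hornerE ex subrr.
have sum_fib : (\sum_(c' in K) #|fib c'| = q ^ 2)%N.
  rewrite -cardF -sum1_card [RHS](partition_big (fun y : F => y ^+ q + y) (mem K)) /=.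
    by apply: eq_bigr => c' _; rewrite -sum1_card; apply: eq_bigl => y; rewrite inE.
  by move=> y _; rewrite inE exprDn_pchar // frob2K addrC.
have cK : c \in K by rewrite inE cq.
have : (\sum_(c' in K) (q - #|fib c'|) == 0)%N.
  rewrite -leqn0 -(leq_add2r (q ^ 2)) -{1}sum_fib -big_split /= add0n.
  rewrite (eq_bigr (fun=> q)) => [|c' _]; last by rewrite subnK.
  by rewrite sum_nat_const leq_mul2r K_le orbT.
rewrite sum_nat_eq0 => /forall_inP/(_ c cK).
by rewrite subn_eq0 => q_le; apply/eqP; rewrite eqn_leq fib_le.
Qed.


Lemma hermitian_pointsP (v : vec3 F) :
  reflect (normalized v /\ herm q (pt v) (pt v) = 0) (v \in hermitian_points F q).
Proof.
rewrite inE (_ : (hermitian_poly F q).@[v] = herm q (pt v) (pt v)) //.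
  by apply: (iffP andP) => -[nv /eqP].
exact: meval_hermitian.
Qed.

Let affine_points := [set xy : F * F | xy.2 ^+ q + xy.2 == xy.1 ^+ q.+1].

(** The norm x^(q+1) is fixed by the q-th power map, so each of the q^2 values of x admits q values
    of y. *)
Let card_affine_points : #|affine_points| = (q ^ 3)%N.
Proof.
have -> : #|affine_points| = (\sum_(x : F) \sum_(y : F | (y ^+ q + y == x ^+ q.+1)%R) 1)%N.
  by rewrite pair_big_dep /= sum1dep_card.
rewrite (eq_bigr (fun=> q)) => [|x _].
  by rewrite sum_nat_const cardF -expnSr.
rewrite sum1dep_card trace_fiber // -exprM mulnC exprM exprSr frob2K -exprS.
by [].
Qed.

(** [phi] dehomogenizes with respect to z; [None] stands for (0:1:0), the only point at infinity
    because z = 0 forces x^(q+1) = 0. *)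
Lemma card_hermitian_points : #|hermitian_points F q| = (q ^ 3 + 1)%N.
Proof.
pose phi (v : vec3 F) := if pt v 2 == 0 then None else Some (pt v 0 / pt v 2, pt v 1 / pt v 2).
have infty (v : vec3 F) : v \in hermitian_points F q -> pt v 2 = 0 -> pt v 0 = 0.
  move=> /hermitian_pointsP[nv]; rewrite hermE => + v2; rewrite v2 expr0n.
  rewrite gtn_eqF ?(ltnW q_gt1) // mulr0 mul0r !add0r => /eqP.
  by rewrite oppr_eq0 -exprS expf_eq0 /= => /eqP.
have phi_inj : {in hermitian_points F q &, injective phi}.
  move=> u v uX vX; have [nu _] := hermitian_pointsP _ uX.
  have [nv _] := hermitian_pointsP _ vX; rewrite /phi.
  case: eqP => [u2|/eqP u2]; case: eqP => [v2|/eqP v2] //.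
    move=> _; apply: normalized_par => //; have u0 := infty _ uX u2; have v0 := infty _ vX v2.
    by apply: ord3P; apply: ord3P => //; rewrite ?u0 ?u2 ?v0 ?v2 ?mulr0 ?mul0r.
  case=> e0 e1; apply: normalized_par => //.
  have E0 : pt u 0 = pt v 0 / pt v 2 * pt u 2 by rewrite -e0 divfK.
  have E1 : pt u 1 = pt v 1 / pt v 2 * pt u 2 by rewrite -e1 divfK.
  by apply: ord3P; apply: ord3P => //; rewrite ?E0 ?E1; field.
rewrite -(card_in_imset phi_inj).
have -> : phi @: hermitian_points F q = None |: [set Some xy | xy in affine_points].
  apply/setP => o; apply/imsetP/setU1P.
    case=> v vX ->; rewrite /phi; case: eqP => [_|/eqP v2]; first by left.
    right; apply: imset_f; rewrite inE /=.
    have [_] := hermitian_pointsP _ vX; rewrite hermE => vv.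
    rewrite exprS !expr_div_n -subr_eq0.
    rewrite (_ : _ - _ = (pt v 1 * pt v 2 ^+ q + pt v 2 * pt v 1 ^+ q - pt v 0 * pt v 0 ^+ q)
      / (pt v 2 * pt v 2 ^+ q)); first by rewrite vv mul0r.
    have := expf_neq0 q v2; move: (pt v 2 ^+ q) (pt v 1 ^+ q) (pt v 0 ^+ q) => x y z.
    by move=> x0; field; rewrite x0 v2.
  case=> [->|/imsetP[[x y] + ->]].
    exists [ffun i => mk3 0 1 0 i]; last by rewrite /phi /pt ffunE /mk3 /= eqxx.
    apply/hermitian_pointsP; split.
      apply/existsP; exists 1; rewrite ffunE eqxx; apply/forallP.
      by apply: ord3P => //; rewrite ffunE /mk3 /= eqxx.
    rewrite hermE /pt !ffunE /mk3 /= !mul0r subr0 addr0 mul1r expr0n.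
    by rewrite gtn_eqF // ltnW.
  rewrite inE /= => /eqP xy.
  have [|c [u nu [c0 wE]]] := @normalize_exists F (mk3 x y 1) 2; first exact: oner_neq0.
  have := wE 2; have := wE 1; have := wE 0; rewrite /mk3 /= => x_ y_ u2.
  have u20 : pt u 2 != 0 by apply: contraTneq (oner_neq0 F) => u0; rewrite u2 u0 mulr0 eqxx.
  exists u; last first.
    rewrite /phi (negbTE u20) -(divr1 x) -(divr1 y) u2 x_ y_.
    by congr (Some (_, _)); field; rewrite u20.
  apply/hermitian_pointsP; split=> //; apply/eqP.
  have ww : herm q (mk3 x y 1) (mk3 x y 1) = 0.
    by rewrite hermE /mk3 /= expr1n mulr1 mul1r [y + _]addrC xy exprS subrr.
  by move/eqP: ww; rewrite (herm_scale q wE) !mulf_eq0 expf_eq0 (negbTE c0) andbF.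
rewrite cardsU1 card_imset; last by move=> ? ? [].
rewrite card_affine_points addnC; congr (_ + _)%N.
by case: imsetP => // -[].
Qed.

(** Each of the q^2 lines x = constant carries q affine points of the curve, more than the degree,
    so f vanishes on all these lines. *)
Lemma dhomog_hermitian_inj d (f : {mpoly F[3]}) : f \is d.-homog -> (d < q)%N ->
  (forall v, v \in hermitian_points F q -> f.@[pt v] = 0) -> f = 0.
Proof.
move=> hf dq f0.
have fX (w : 'I_3 -> F) i : w i != 0 -> herm q w w = 0 -> f.@[w] = 0.
  move=> wi ww; have [c [u nu [c0 wE]]] := normalize_exists wi.
  rewrite (meval_eq _ wE) (meval_dhomog_scale _ _ hf) f0 ?mulr0 //.
  apply/hermitian_pointsP; split=> //; apply/eqP; move/eqP: ww.
  by rewrite (herm_scale q wE) !mulf_eq0 expf_eq0 (negbTE c0) andbF.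
apply: (@dhomog_vanish_lines F d f (enum F)) => //; first exact: enum_uniq.
  by rewrite -cardE cardF; apply: leq_trans dq _; rewrite -{1}(expn1 q) leq_exp2l.
move=> x _; pose Y := [set y : F | y ^+ q + y == x ^+ q.+1].
apply: (@roots_geq_poly_eq0 _ _ (enum Y)).
- apply/allP => y; rewrite mem_enum inE => /eqP yY; rewrite /root horner_restr.
  apply/eqP/(fX _ 2); first by rewrite /mk3 /= mulr0 addr0 oner_eq0.
  rewrite hermE /mk3 /= !mulr0 !mulr1 !addr0 !add0r expr1n mulr1 mul1r.
  by rewrite [y + _]addrC yY exprS subrr.
- exact: enum_uniq.
rewrite -cardE trace_fiber; first exact: leq_trans (size_restr _ _ hf) _.
by rewrite -exprM mulnC exprM exprSr frob2K -exprS.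
Qed.

End HermitianCurve.

(** * Coordinates given by two points of the curve and the pole of their secant *)

Section PolarTriangle.
Variables (F : fieldType) (q : nat).
Hypotheses (q_gt1 : (1 < q)%N) (q_char : [pchar F].-nat q).
Hypothesis q2K : forall x : F, (x ^+ q) ^+ q = x.
Variables P V U : 'I_3 -> F.
Local Notation "''[' u , v ]" := (@herm F q u v) (format "''[' u ,  v ]").
Hypotheses (PP : '[P, P] = 0) (VV : '[V, V] = 0) (PV : '[P, V] != 0).
Hypotheses (PU : '[P, U] = 0) (VU : '[V, U] = 0) (UU : '[U, U] != 0).

Let sym u v : '[v, u] = '[u, v] ^+ q.
Proof. exact: herm_sym. Qed.

Let VP : '[V, P] != 0.
Proof. by rewrite sym expf_neq0. Qed.

Let sym0 u v : '[u, v] = 0 -> '[v, u] = 0.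
Proof. by move=> uv; rewrite sym uv expr0n gtn_eqF // ltnW. Qed.

Let UP : '[U, P] = 0. Proof. exact: sym0. Qed.
Let UV : '[U, V] = 0. Proof. exact: sym0. Qed.

(** The form pairs [P] with [V] and [U] with itself, all other pairings being zero, so coordinates
    are read off by pairing. *)
Lemma polar_triangle_decomp x k : x k =
  '[x, V] / '[P, V] * P k + '[x, P] / '[V, P] * V k + '[x, U] / '[U, U] * U k.
Proof.
have herm0 y : (forall i, y i = 0) -> forall z, '[y, z] = 0.
  by move=> y0 z; rewrite hermE !y0; ring.
have [|a [b [c xE]]] := @basis3 F P V U _ x.
  move=> a b c /herm0 H; have := H P; have := H V; have := H U; rewrite !herm_comb.
  rewrite PU VU UV UP PP VV !mulr0 !addr0 !add0r.
  by move=> /eqP + /eqP + /eqP; rewrite !mulf_eq0 (negbTE PV) (negbTE UU) (negbTE VP)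
    !orbF => /eqP-> /eqP-> /eqP->.
have hE z : '[x, z] = a * '[P, z] + b * '[V, z] + c * '[U, z].
  by rewrite -herm_comb !hermE !xE.
rewrite !hE PU VU UV UP PP VV !mulr0 !addr0 !add0r xE.
by rewrite !mulfK.
Qed.

Lemma polar_triangle_dot0 n : dot n P = 0 -> dot n V = 0 -> dot n U = 0 ->
  forall x, dot n x = 0.
Proof.
move=> nP nV nU x; move: nP nV nU; rewrite /dot !sum_ord3 => nP nV nU.
rewrite !(polar_triangle_decomp x).
move: ('[x, V] / _) ('[x, P] / _) ('[x, U] / _) => a b c.
rewrite [LHS](_ : _ = a * (n 0 * P 0 + n 1 * P 1 + n 2 * P 2)
  + b * (n 0 * V 0 + n 1 * V 1 + n 2 * V 2) + c * (n 0 * U 0 + n 1 * U 1 + n 2 * U 2)).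
  by rewrite nP nV nU; ring.
by ring.
Qed.

(** The coordinates [A], [B], [T] are the normalized polars of [V], [U], [P]. The polar of [P] is
    the tangent there; it contains [U], and on it the equation of the curve becomes a multiple of
    t^(q+1). *)
Lemma vanishes_tangentP (p : vec3 F) a d (f : {mpoly F[3]}) : pt p = P ->
  (a <= q.+1)%N -> f \is d.-homog ->
  vanishes_on_multiple_point (hermitian_poly F q) p a f <-> 'X^a %| restr P U f.
Proof.
move=> pP aq hf.
pose A := '[P, V]^-1 *: linform (polar q V).
pose B := '[U, U]^-1 *: linform (polar q U).
pose T := '[V, P]^-1 *: linform (polar q P).
have coordE i : 'X_i = P i *: A + U i *: B + V i *: T.
  (* Decomposing the standard basis vectors gives the identity coefficient by coefficient. *)
  have delta (j : 'I_3) : (j == i)%:R = P i / '[P, V] * polar q V j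
      + U i / '[U, U] * polar q U j + V i / '[V, P] * polar q P j.
    have hj z : '[(fun k => (k == j)%:R), z] = polar q z j.
      rewrite /herm /dot (bigD1 j) //= eqxx mulr1 big1 ?addr0 // => k kj.
      by rewrite (negbTE kj) mulr0.
    have := polar_triangle_decomp (fun k => (k == j)%:R) i.
    by rewrite !hj eq_sym => ->; ring.
  rewrite /A /B /T /linform !scalerA !scaler_sumr -!big_split /=.
  rewrite (bigD1 i) //= [X in _ = X + _](_ : _ = 'X_i); last first.
    by rewrite !scalerA -!scalerDl -delta eqxx scale1r.
  rewrite big1 ?addr0 // => j ji.
  by rewrite !scalerA -!scalerDl -delta (negbTE ji) scale0r.
apply: (@vanishes_on_multiple_pointP F P U V A B T _ _ coordE _ _ _ _ _ q _ d) => //.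
- exact/rpredZ/linform_homog.
- exact/rpredZ/linform_homog.
- rewrite restrZ restr_linform -!/(herm _ _ _) PU polyC0 add0r scalerA.
  by rewrite mulVf // scale1r.
- by rewrite restrZ restr_linform -!/(herm _ _ _) PP UP polyC0 add0r scale0r scaler0.
- by rewrite restrZ restr_linform -!/(herm _ _ _) PU VU polyC0 add0r scale0r scaler0.
- rewrite restrZ restr_linform -!/(herm _ _ _) PP polyC0 add0r scalerA.
  by rewrite mulVf // scale1r.
- by move=> i; rewrite -pP.
- exact: hermitian_homog.
- by rewrite restr_hermitian // PP PU UP polyC0 !scale0r !add0r dvdpZr.
- rewrite restr_hermitian // PP VV polyC0 scale0r add0r addr0 coefD !coefZ coefX.
  by rewrite coefXn (ltn_eqF q_gt1) mulr1 mulr0 addr0.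
Qed.

End PolarTriangle.

(** * The setting of the code: the points, their tangents and the forms vanishing on E *)

Lemma dvd_XnP (F : fieldType) a (p : {poly F}) :
  reflect (forall k, (k < a)%N -> p`_k = 0) ('X^a %| p).
Proof.
apply: (iffP (dvdpP _ _)) => [[r ->] k ka|p0]; first by rewrite coefMXn ka.
exists (drop_poly a p); rewrite -[LHS](poly_take_drop a) [take_poly _ _](_ : _ = 0) ?add0r //.
by apply/polyP => k; rewrite coef_take_poly coef0; case: ltnP => // /p0.
Qed.

Lemma card_ord_ltn s m : (#|[set i : 'I_s | (i < m)%N]| <= m)%N.
Proof.
rewrite cardE -(size_map val) -[X in (_ <= X)%N](size_iota 0 m).
apply: uniq_leq_size; first by rewrite (map_inj_uniq val_inj) enum_uniq.
by move=> _ /mapP[i + ->]; rewrite mem_enum inE mem_iota.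
Qed.

Section HermitianCode.
Variables (F : finFieldType) (q : nat).
Hypothesis q_pp : exists p k : nat, [/\ prime p, (0 < k)%N & q = (p ^ k)%N].
Hypothesis cardF : #|F| = (q ^ 2)%N.
Variables (s d : nat).
Hypotheses (hs : (2 <= s)%N) (hsd : (s <= d.-1)%N) (hdq : (d.-1 <= q - 2)%N).
Variable a : 'I_s -> nat.
Hypothesis ha : forall i : 'I_s, (0 < a i <= d + 1 - i.+1)%N.
Variable P : 'I_s -> vec3 F.
Hypotheses (P_inj : injective P) (P_X : forall i, P i \in hermitian_points F q).
Variable l : vec3 F.
Hypotheses (l_nz : l != 0) (P_R : forall i, P i \in line_points l).
Variable rep : vec3 F -> vec3 F.
Hypothesis hrep : forall v, v \in hermitian_points F q ->
  exists2 c : F, c != 0 & rep v = c *: v.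

Local Notation X := (hermitian_points F q).
Local Notation B := (X :\: [set P i | i : 'I_s]).
Local Notation "''[' u , v ]" := (@herm F q u v) (format "''[' u ,  v ]").
Local Notation p_ i := (pt (P i)).

Let q_gt1 := prime_power_gt1 q_pp.
Let q_char := prime_power_pchar q_pp cardF.
Let q2K := frob2K cardF.

(* The pole of the line l: it lies on the tangent to the curve at every P i. *)
Let U : 'I_3 -> F := mk3 ((- pt l 0) ^+ q) (pt l 2 ^+ q) (pt l 1 ^+ q).

Let lE v : dot (pt l) v = '[v, U].
Proof. by rewrite hermE /dot sum_ord3 /U /mk3 /= !q2K; ring. Qed.

Let line_pointsP v : v \in line_points l = normalized v && (dot (pt l) (pt v) == 0).
Proof. by rewrite inE. Qed.

Let lP i : dot (pt l) (p_ i) = 0.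
Proof. by have := P_R i; rewrite line_pointsP => /andP[_ /eqP]. Qed.

Let PU i : '[p_ i, U] = 0.
Proof. by rewrite -lE lP. Qed.

Let UP i : '[U, p_ i] = 0.
Proof. by rewrite herm_sym // PU expr0n gtn_eqF // ltnW. Qed.

Let P_norm i : normalized (P i).
Proof. by have [] := hermitian_pointsP q _ (P_X i). Qed.

Let PP i : '[p_ i, p_ i] = 0.
Proof. by have [] := hermitian_pointsP q _ (P_X i). Qed.

(* A tangent at a rational point of the curve contains no other rational point. *)
Let herm_neq0 u v : u \in X -> v \in X -> u != v -> '[pt u, pt v] != 0.
Proof.
move=> /hermitian_pointsP[nu uu] /hermitian_pointsP[nv vv]; apply: contraNneq => uv.
by apply/eqP/normalized_par => //; apply: (herm_isotropic_par q_gt1).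
Qed.

Let other (i : 'I_s) : exists j, j != i.
Proof.
exists (if i == Ordinal (ltnW hs) then Ordinal hs else Ordinal (ltnW hs)).
by case: (eqVneq i (Ordinal (ltnW hs))) => [->|] //; rewrite eq_sym.
Qed.

Let PPn i j : j != i -> '[p_ i, p_ j] != 0.
Proof. by move=> ji; apply: herm_neq0 => //; rewrite (inj_eq P_inj) eq_sym. Qed.

(** An isotropic [U] would be parallel to every [P i], since it is orthogonal to them, and two of
    these points would coincide; [U] is nonzero because [l] is. *)
Let UU : '[U, U] != 0.
Proof.
have [k Uk] : exists k, U k != 0.
  case: (pickP (fun k => U k != 0)) => [k Uk|U0]; first by exists k.
  case/eqP: l_nz; apply/ffunP => i; rewrite ffunE.
  have dl0 v : dot (pt l) v = 0.
    have {}U0 j : U j = 0 by apply/eqP/negPn; rewrite U0.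
    by rewrite lE hermE !U0 expr0n gtn_eqF 1?ltnW // !mulr0; ring.
  have := dl0 (fun k => (k == i)%:R); rewrite /dot (bigD1 i) //= eqxx mulr1.
  by rewrite big1 ?addr0 // => j /negbTE->; rewrite mulr0.
apply: contra_neq Uk => UU0.
pose i0 := Ordinal hs; have [i1 i10] := other i0.
have par_U i : par (p_ i) U := herm_isotropic_par q_gt1 q_char q2K (PP i) UU0 (PU i).
apply/eqP; apply: contraTT i10 => Uk; apply/negPn/eqP/P_inj/normalized_par => // i j.
have /eqP := par_mul0 (par_U i1) (par_U i0) i j k.
by rewrite mulf_eq0 (negbTE Uk) orbF subr_eq0 => /eqP.
Qed.

Let lU : dot (pt l) U != 0.
Proof. by rewrite lE. Qed.

Let a_gt0 i : (0 < a i)%N. Proof. by case/andP: (ha i). Qed.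

(** Indices start at 0, so the bound reads a i <= d - i, and t < a i forces i < d - t. This is the
    criterion for interpolating jets in degree d - 1. *)
Let a_count t : (#|[set i | (t < a i)%N]| <= d - t)%N.
Proof.
apply: leq_trans (card_ord_ltn s _); apply: subset_leq_card; apply/subsetP => i.
by rewrite !inE => ti; have := ha i; lia.
Qed.

Let on_E (f : {mpoly F[3]}) := forall i, 'X^(a i) %| restr (p_ i) U f.

Let vanishesP f : f \is d.-homog ->
  (forall i, vanishes_on_multiple_point (hermitian_poly F q) (P i) (a i) f) <-> on_E f.
Proof.
move=> hf; have E i : vanishes_on_multiple_point (hermitian_poly F q) (P i) (a i) f
    <-> 'X^(a i) %| restr (p_ i) U f.
  have [j ji] := other i.
  apply: (vanishes_tangentP q_gt1 q_char q2K (PP i) (PP j) (PPn ji) (PU i) (PU j) UU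
    (erefl (p_ i)) _ hf).
  by have := ha i; lia.
by split=> H i; apply/E.
Qed.

Let on_E_meval f i : on_E f -> f.@[p_ i] = 0.
Proof.
move=> /(_ i); rewrite -(restr0 _ U) => dv; apply/eqP; rewrite -dvdX.
by apply: dvdp_trans dv; rewrite -{1}(expr1 'X) dvdp_exp2l.
Qed.

Let meval_rep d' (f : {mpoly F[3]}) v : f \is d'.-homog -> v \in X ->
  exists2 c, c != 0 & f.@[pt (rep v)] = c * f.@[pt v].
Proof.
move=> hf /hrep[c c0 ->]; exists (c ^+ d'); first exact: expf_neq0.
rewrite -(meval_dhomog_scale _ _ hf); apply: meval_eq => i.
by rewrite /pt ffunE.
Qed.

Let tangents : {mpoly F[3]} := \prod_(i < s) linform (polar q (p_ i)).

Let tangents_homog : tangents \is s.-homog.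
Proof.
have := @dhomog_prod_linear 3 F _ (enum 'I_s) (fun i => linform (polar q (p_ i)))
  (fun i => linform_homog _).
by rewrite size_enum_ord big_enum.
Qed.

(** The i-th factor vanishes identically on the tangent at [P i], so every order of contact is
    reached. *)
Let tangents_on_E g : on_E (tangents * g).
Proof.
move=> i; rewrite rmorphM /= rmorph_prod /= (bigD1 i) //= restr_linform.
by rewrite -!/(herm _ _ _) PP UP polyC0 add0r scale0r !mul0r dvdp0.
Qed.

Let B_X v : v \in B -> v \in X. Proof. by case/setDP. Qed.

Let B_norm v : v \in B -> normalized v.
Proof. by case/setDP => /hermitian_pointsP[]. Qed.

Let B_P v i : v \in B -> v != P i.
Proof. by case/setDP=> _; apply: contraNneq => ->; rewrite imset_f. Qed.

Let tangents_neq0 v : v \in B -> tangents.@[pt v] != 0.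
Proof.
move=> vB; rewrite rmorph_prod /=; apply/prodf_neq0 => i _.
by rewrite meval_linform -/(herm _ _ _); apply: herm_neq0 => //; [apply: B_X | apply: B_P].
Qed.


(** * Words of the dual code: minimum weight, and collinearity of the supports *)

Local Notation C := (eval_code (hermitian_poly F q) B rep d P a).
Local Notation Cp := (dual_code B C).

Let word (f : {mpoly F[3]}) : {ffun vec3 F -> F^o} :=
  [ffun v => if v \in B then f.@[pt (rep v)] else 0].

Let word_code_setP c : c \in eval_code_set (hermitian_poly F q) B rep d P a <->
  exists f, [/\ f \is d.-homog, on_E f & c = word f].
Proof.
rewrite inE /asb; case: ClassicalDescription.excluded_middle_informative => [H|nH]; split=> //.
- move=> _; case: H => f [hf /(vanishesP hf) fE cE]; exists f; split=> //.
  by apply/ffunP => v; rewrite ffunE cE.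
- case=> f [hf /(vanishesP hf) fE cE]; case: nH; exists f; split=> // v.
  by rewrite cE ffunE.
Qed.

Let word_code f : f \is d.-homog -> on_E f -> word f \in C.
Proof.
by move=> hf fE; apply: memv_span; rewrite mem_enum; apply/word_code_setP; exists f.
Qed.

(* If a form vanishing on E separates Q from the rest of the support of w, then
   pairing w with the corresponding codeword isolates the coordinate w Q. *)
Let dual_no_separation w Q f : w \in Cp -> Q \in supp w -> f \is d.-homog -> on_E f ->
  (forall v, v \in supp w -> v != Q -> f.@[pt v] = 0) -> f.@[pt Q] = 0.
Proof.
rewrite inE => /andP[wB /forallP wC] Qw hf fE f0.
have QB : Q \in B := subsetP wB _ Qw.
have := wC (word f); rewrite (word_code hf fE) /= (bigD1 Q) //= big1 => [|v /andP[vB vQ]].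
  have [c c0 E] := meval_rep hf (B_X QB).
  rewrite addr0 ffunE QB E mulf_eq0 mulf_eq0 (negbTE c0) /=.
  by move: Qw; rewrite inE => /negbTE-> /eqP.
have [->|wv] := eqVneq (w v) 0; first by rewrite mul0r.
have [c c0 E] := meval_rep hf (B_X vB).
by rewrite ffunE vB E f0 ?inE // !mulr0.
Qed.

Let supp_B w v : w \in Cp -> v \in supp w -> v \in B.
Proof. by rewrite inE => /andP[/subsetP wB _] /wB. Qed.

Let supp_neq0 (w : {ffun vec3 F -> F^o}) : w != 0 -> exists v, v \in supp w.
Proof.
move=> w0; case: (pickP (mem (supp w))) => [v vw|w0']; first by exists v.
case/eqP: w0; apply/ffunP => v; rewrite ffunE; apply/eqP/negPn.
by have := w0' v; rewrite /= inE => ->.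
Qed.

Lemma dual_min_weight w : w \in Cp -> w != 0 -> (d + 2 - s <= weight w)%N.
Proof.
move=> wC /supp_neq0[Q Qw]; rewrite leqNgt; apply/negP => lt_w.
pose vs := enum (supp w :\ Q); have QB := supp_B wC Qw.
(* Degree d - s is left after the s tangents, enough for a line through each other point of the
   support. *)
have [||g [hg gQ g0]] := @separating_form F Q vs (d - s) (B_norm QB).
- move=> v; rewrite mem_enum => /setD1P[vQ vw]; split; last by rewrite eq_sym.
  by apply: B_norm; apply: supp_B vw.
- rewrite -cardE; move: lt_w; rewrite /weight (cardsD1 Q) Qw.
  by move: #|_| (hsd) => k; clear; lia.
have : (tangents * g).@[pt Q] = 0.
  apply: (dual_no_separation wC Qw) => //.
    have dE : (s + (d - s))%N = d by move: (hs) (hsd); clear; lia.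
    by rewrite -dE; apply: dhomogM.
  by move=> v vw vQ; rewrite mevalM g0 ?mulr0 // mem_enum !inE vQ; rewrite inE in vw.
by apply/eqP; rewrite mevalM mulf_neq0 // tangents_neq0.
Qed.

Let dual_collinear w Q1 Q2 Q : w \in Cp -> weight w = (d + 2 - s)%N ->
  Q1 \in supp w -> Q2 \in supp w -> Q \in supp w -> Q1 != Q2 ->
  dot (cross (pt Q1) (pt Q2)) (pt Q) = 0.
Proof.
move=> wC ww Q1w Q2w Qw Q12.
have [->|QQ1] := eqVneq Q Q1; first exact: dot_crossl.
have [->|QQ2] := eqVneq Q Q2; first exact: dot_crossr.
apply/eqP; apply/negPn/negP => nz.
pose vs := enum (supp w :\ Q :\ Q1 :\ Q2); have QB := supp_B wC Qw.
(* The line through [Q1] and [Q2] handles two points for one degree; d - 1 - s degrees remain for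
   the other d - 1 - s points. *)
have [||g [hg gQ g0]] := @separating_form F Q vs (d - s.+1) (B_norm QB).
- move=> v; rewrite mem_enum => /setD1P[_ /setD1P[_ /setD1P[vQ vw]]].
  split; last by rewrite eq_sym.
  by apply: B_norm; apply: supp_B vw.
- have m1 : Q1 \in supp w :\ Q by rewrite in_setD1 eq_sym QQ1.
  have m2 : Q2 \in supp w :\ Q :\ Q1.
    by rewrite 2!in_setD1 Q2w andbT eq_sym Q12 eq_sym QQ2.
  rewrite -cardE; move: ww; rewrite /weight (cardsD1 Q) Qw (cardsD1 Q1 (_ :\ Q)) m1.
  rewrite (cardsD1 Q2 (_ :\ Q1)) m2.
  by move: #|_| (hsd) => k; clear; lia.
pose n := linform (cross (pt Q1) (pt Q2)).
have : (tangents * (n * g)).@[pt Q] = 0.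
  apply: (dual_no_separation wC Qw) => //.
    have dE : (s + (1 + (d - s.+1)))%N = d by move: (hs) (hsd); clear; lia.
    rewrite -dE; apply: dhomogM => //; apply: dhomogM => //; exact: linform_homog.
  move=> v vw vQ; rewrite !mevalM meval_linform.
  have [->|vQ1] := eqVneq v Q1; first by rewrite dot_crossl mul0r mulr0.
  have [->|vQ2] := eqVneq v Q2; first by rewrite dot_crossr mul0r mulr0.
  by rewrite g0 ?mulr0 // mem_enum !in_setD1 vQ1 vQ2 vQ.
by apply/eqP; rewrite !mevalM meval_linform !mulf_neq0 // tangents_neq0.
Qed.


Let triangle_dot0 n i j : j != i -> dot n (p_ i) = 0 -> dot n (p_ j) = 0 ->
  dot n U = 0 -> forall x, dot n x = 0.
Proof.
move=> ji.
exact: (polar_triangle_dot0 q_gt1 q_char q2K (PP i) (PP j) (PPn ji) (PU i) (PU j) UU).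
Qed.

Let triangle_decomp i j (x : 'I_3 -> F) k : j != i -> x k =
  '[x, p_ j] / '[p_ i, p_ j] * p_ i k + '[x, p_ i] / '[p_ j, p_ i] * p_ j k
  + '[x, U] / '[U, U] * U k.
Proof.
move=> ji; exact: (polar_triangle_decomp q_gt1 q_char q2K (PP i) (PP j) (PPn ji) (PU i) (PU j) UU).
Qed.

Let dot_comb n b1 b2 b3 (u v w x : 'I_3 -> F) :
  (forall k, x k = b1 * u k + b2 * v k + b3 * w k) ->
  dot n x = b1 * dot n u + b2 * dot n v + b3 * dot n w.
Proof. by move=> xE; rewrite /dot !sum_ord3 !xE; ring. Qed.

(* The support of a word of weight d + 2 - s lies on a line n; were n different from l,
   a form of degree d separating Q from the other points of the support and from the
   point P i on n (if any) could be corrected by a multiple of n to vanish on E. *)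
Lemma dual_min_weight_on_line w Q : w \in Cp -> weight w = (d + 2 - s)%N ->
  Q \in supp w -> dot (pt l) (pt Q) = 0.
Proof.
move=> wC ww Qw; apply/eqP/negPn/negP => lQ.
have QB := supp_B wC Qw.
have [Q2 Q2w QQ2] : exists2 Q2, Q2 \in supp w & Q != Q2.
  case: (pickP (mem (supp w :\ Q))) => [v /setD1P[vQ vw]|w0].
    by exists v; rewrite // eq_sym.
  move: ww; rewrite /weight (cardsD1 Q) Qw (eq_card0 w0).
  by move: (hs) (hsd); clear; lia.
pose n := cross (pt Q) (pt Q2).
have nS v : v \in supp w -> dot n (pt v) = 0 by move=> vw; apply: (dual_collinear wC ww).
have n_neq0 : ~ (forall x, dot n x = 0).
  move=> n0; case/eqP: QQ2; apply: normalized_par; try exact: B_norm (supp_B wC _).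
  apply: par_cross0 => i; have := n0 (fun k => (k == i)%:R).
  rewrite /dot (bigD1 i) //= eqxx mulr1 big1 ?addr0 // => j /negbTE->.
  by rewrite mulr0.
(* A line through [P i] and [U] is the tangent at [P i] and would miss [Q]. *)
have nU i : dot n (p_ i) = 0 -> dot n U != 0.
  move=> ni; apply/negP => /eqP nU; have [j ji] := other i.
  have := dot_comb n (fun k => triangle_decomp (pt Q) k ji).
  rewrite (nS _ Qw) ni nU !mulr0 add0r addr0 => /esym/eqP.
  have hji : '[p_ j, p_ i] != 0 by apply: PPn; rewrite eq_sym.
  have hQi := herm_neq0 (B_X QB) (P_X i) (B_P i QB).
  rewrite !mulf_eq0 invr_eq0 (negbTE hQi) (negbTE hji) /= => /eqP nj.
  exact/n_neq0/(triangle_dot0 ji).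
(* Two of the points [P i] on n would make it the line [l], which misses [Q]. *)
have n_uniq i j : dot n (p_ i) = 0 -> dot n (p_ j) = 0 -> j = i.
  move=> ni nj; apply/eqP/negPn/negP => ji.
  have := dot_comb n (fun k => triangle_decomp (pt Q) k ji).
  rewrite (nS _ Qw) ni nj !mulr0 !add0r => /esym/eqP.
  rewrite !mulf_eq0 invr_eq0 (negbTE UU) -lE (negbTE lQ) /=.
  by rewrite (negbTE (nU i ni)).
(* If no [P i] lies on n, the default merely prescribes an extra zero; the d + 2 - s prescribed
   zeros are at most d because s >= 2. *)
pose i0 := odflt (Ordinal hs) [pick i | dot n (p_ i) == 0].
have i0E i : dot n (p_ i) = 0 -> i = i0.
  move=> ni; rewrite /i0; case: pickP => [j /eqP nj|/(_ i)]; first exact: n_uniq.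
  by rewrite ni eqxx.
pose vs := P i0 :: enum (supp w :\ Q).
have [||f0 [hf0 f0Q f00]] := @separating_form F Q vs d (B_norm QB).
- move=> v; rewrite in_cons mem_enum => /orP[/eqP->|/setD1P[vQ vw]].
    by split; rewrite ?P_norm ?B_P.
  split; last by rewrite eq_sym.
  by apply: B_norm; apply: supp_B vw.
- rewrite /= -cardE; move: ww; rewrite /weight (cardsD1 Q) Qw.
  by move: #|_| (hs) (hsd) => k; clear; lia.
(* [c i] is the quotient of f0 by n modulo t^(a i). Off n the restriction of n is invertible modulo
   t^(a i); at a point on n it is t times a nonzero constant, and f0 is divisible by t too. *)
have /fin_all_exists[c Hc] i : exists c : {poly F},
    'X^(a i) %| restr (p_ i) U f0 - restr (p_ i) U (linform n) * c.
  rewrite restr_linform; have [ni|ni] := eqVneq (dot n (p_ i)) 0.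
    have X_dvd : 'X %| restr (p_ i) U f0.
      by rewrite dvdX restr0 f00 // (i0E i ni) mem_head.
    exists ((dot n U)^-1 *: (restr (p_ i) U f0 %/ 'X)).
    rewrite -scalerAr ni polyC0 add0r -scalerAl scalerA mulVf ?(nU i) // scale1r.
    by rewrite mulrC divpK // subrr dvdp0.
  set L := _ + _; have L0 : L.[0] != 0.
    by rewrite /L hornerD hornerC hornerZ hornerX mulr0 addr0.
  have /Bezout_eq1_coprimepP[[u v] /= uv] := coprimep_Xn (a i) L0.
  exists (v * restr (p_ i) U f0).
  rewrite [X in _ %| X](_ : _ = restr (p_ i) U f0 * (1 - v * L)); last by ring.
  by rewrite -uv addrK dvdp_mull // dvdp_mull.
have [|g hg Hg] := @jet_interpolation F s P (pt l) U P_norm P_inj lP lU d.-1 a c.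
  move=> t; have -> : d.-1.+1 = d by move: (hs) (hsd); clear; lia.
  exact: a_count.
(* Subtracting n g gives vanishing on E and changes no value on n, which contains the support. *)
have : (f0 - linform n * g).@[pt Q] = 0.
  apply: (dual_no_separation wC Qw).
  - apply: rpredB => //; have dE : (1 + d.-1)%N = d by move: (hs) (hsd); clear; lia.
    by rewrite -dE; apply: dhomogM hg; apply: linform_homog.
  - move=> i; rewrite raddfB /= rmorphM /=.
    rewrite [X in _ %| X](_ : _ = (restr (p_ i) U f0 - restr (p_ i) U (linform n) * c i)
      + restr (p_ i) U (linform n) * (c i - restr (p_ i) U g)); last by ring.
    by rewrite dvdp_add // dvdp_mull.
  move=> v vw vQ; rewrite mevalB mevalM meval_linform nS // mul0r subr0 f00 //.
  by rewrite in_cons mem_enum in_setD1 vQ vw orbT.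
by rewrite mevalB mevalM meval_linform nS // mul0r subr0; apply/eqP.
Qed.


(** * Dimension of the code *)

Let jet_index := {i : 'I_s & 'I_(a i)}.

Let jet (f : dhomog 3 F d) : {ffun jet_index -> F^o} :=
  [ffun k : jet_index => (restr (p_ (tag k)) U (val f))`_(tagged k)].

Let jet_linear : linear jet.
Proof.
move=> c f g; apply/ffunP => k; rewrite !ffunE /=.
by rewrite raddfD /= restrZ coefD coefZ.
Qed.

HB.instance Definition _ := GRing.isLinear.Build F _ _ _ jet jet_linear.

Let ev (f : dhomog 3 F d) : {ffun vec3 F -> F^o} := word (val f).

Let ev_linear : linear ev.
Proof.
move=> c f g; apply/ffunP => v; rewrite !ffunE /=.
rewrite mevalD mevalZ; case: ifP => // _.
by rewrite scaler0 addr0.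
Qed.

HB.instance Definition _ := GRing.isLinear.Build F _ _ _ ev ev_linear.

Let lker_jetP (f : dhomog 3 F d) : reflect (on_E (val f)) (f \in lker (linfun jet)).
Proof.
rewrite memv_ker lfunE; apply: (iffP eqP) => [f0 i|fE].
  apply/dvd_XnP => k ka; have /ffunP/(_ (Tagged (fun i => 'I_(a i)) (Ordinal ka))) := f0.
  by rewrite !ffunE.
by apply/ffunP => k; rewrite !ffunE; apply/(dvd_XnP _ _ (fE (tag k))).
Qed.

(** The evaluations already form a subspace, so taking the span adds nothing and rank-nullity
    becomes available. *)
Let codeE : C = (linfun ev @: lker (linfun jet))%VS.
Proof.
apply/eqP; rewrite eqEsubv; apply/andP; split.
  apply/span_subvP => c; rewrite mem_enum => /word_code_setP[f [hf fE ->]].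
  apply/memv_imgP; exists (DHomog hf); first exact/lker_jetP.
  by rewrite lfunE.
apply/subvP => c /memv_imgP[[f hf] /lker_jetP fE ->]; rewrite lfunE.
exact: word_code.
Qed.

Let codeP c : reflect (exists f, [/\ f \is d.-homog, on_E f & c = word f]) (c \in C).
Proof.
rewrite codeE; apply: (iffP memv_imgP) => [[[f hf] /lker_jetP fE ->]|[f [hf fE ->]]].
  by exists f; rewrite lfunE.
by exists (DHomog hf); [apply/lker_jetP | rewrite lfunE].
Qed.

(** The jet map is onto by interpolation in degree d. Evaluation is injective on its kernel: a form
    vanishing on E and at [B] vanishes at all rational points, and d < q. *)
Lemma dim_eval_code : \dim C = ('C(d + 2, 2) - \sum_(i < s) a i)%N.
Proof.
have jet_surj : limg (linfun jet) = fullv.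
  apply/eqP; rewrite eqEsubv subvf; apply/subvP => c _; apply/memv_imgP.
  pose ck (i : 'I_s) (k : nat) : F :=
    if insub k is Some k' then c (Tagged (fun i => 'I_(a i)) (k' : 'I_(a i))) else 0.
  pose cp i : {poly F} := \poly_(k < a i) ck i k.
  have [|f hf Hf] := @jet_interpolation F s P (pt l) U P_norm P_inj lP lU d a cp.
    by move=> t; apply: leq_trans (a_count t) _; apply: leq_sub2r.
  exists (DHomog hf); first exact: memvf.
  apply/ffunP => -[i k]; rewrite lfunE ffunE /=.
  have /dvd_XnP/(_ k (ltn_ord k)) := Hf i.
  rewrite coefB coef_poly ltn_ord /ck valK => /eqP; rewrite subr_eq0 => /eqP <-.
  by [].
rewrite codeE limg_dim_eq.
  have := limg_ker_dim (linfun jet) fullv; rewrite capfv jet_surj !dimvf.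
  rewrite [X in (_ + X)%N = _]muln1 card_tagged.
  rewrite [X in _ = X -> _](_ : _ = 'C(d + 2, 2)); last first.
    by rewrite -[RHS](bin_sub (leq_addl _ _)) addnK.
  rewrite sumnE big_map big_enum /= => <-.
  by rewrite (eq_bigr a) ?addnK // => i _; rewrite card_ord.
apply/eqP; rewrite -subv0; apply/subvP => -[f hf].
rewrite memv_cap => /andP[/lker_jetP fE]; rewrite memv_ker lfunE => /eqP/ffunP fB.
rewrite memv0; apply/eqP/val_inj; rewrite /= in fE *.
apply: (dhomog_hermitian_inj q_pp cardF hf); first by move: (hs) (hsd) (hdq); clear; lia.
move=> v vX; have [/imsetP[i _ ->]|vP] := boolP (v \in [set P i | i : 'I_s]).
  exact: on_E_meval.
have vB : v \in B by rewrite inE vP.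
have := fB v; rewrite !ffunE vB; have [c c0 -> /eqP] := meval_rep hf vX.
by rewrite mulf_eq0 (negbTE c0) => /eqP.
Qed.


(** * Words supported on the line through the points [P i] *)

Let line_param i Q v : Q \in B -> Q \in line_points l -> v \in line_points l -> v != Q ->
  exists t, exists2 c, c != 0 & forall k, pt v k = c * (p_ i k + t * pt Q k).
Proof.
move=> QB; rewrite !line_pointsP => /andP[nQ /eqP lQ] /andP[nv /eqP lv] vQ.
have [j ji] := other i.
have hQi := herm_neq0 (B_X QB) (P_X i) (B_P i QB).
have hji : '[p_ j, p_ i] != 0 by apply: PPn; rewrite eq_sym.
have Qk k := triangle_decomp (pt Q) k ji; have vk k := triangle_decomp (pt v) k ji.
rewrite lE in lQ; rewrite lE in lv.
rewrite {}lQ {}lv !mul0r in Qk vk.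
set a1 := '[pt Q, p_ j] / _ in Qk; set b1 := '[pt Q, p_ i] / _ in Qk.
set a2 := '[pt v, p_ j] / _ in vk; set b2 := '[pt v, p_ i] / _ in vk.
have b10 : b1 != 0 by rewrite mulf_neq0 ?invr_eq0.
(* On [l] the [U]-coordinates vanish; eliminating [P j] between the decompositions of v and [Q]
   leaves this coefficient at [P i]. *)
pose c := a2 - b2 * a1 / b1.
have vE k : pt v k = c * p_ i k + b2 / b1 * pt Q k.
  by rewrite vk Qk /c; field.
have c0 : c != 0.
  apply: contraNneq vQ => c0; apply/eqP/normalized_par => // k k'.
  by rewrite !vE c0; ring.
exists (b2 / b1 / c), c => // k; rewrite vE; field.
by rewrite c0.
Qed.

(* On the line l, parametrized as P i + t Q, the value at Q is the coefficient of t^d. *)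
Let line_form_vanish f Q (Z : {set vec3 F}) : f \is d.-homog -> Q \in B ->
  Q \in line_points l -> Z \subset line_points l -> Q \notin Z -> (d < #|Z|)%N ->
  (forall v, v \in Z -> f.@[pt v] = 0) -> f.@[pt Q] = 0.
Proof.
move=> hf QB Ql /subsetP Zl QZ cZ fZ; pose i := Ordinal hs.
have /fin_all_exists[t Ht] v : exists t, v \in Z -> exists2 c, c != 0 &
    forall k, pt v k = c * (p_ i k + t * pt Q k).
  have [vZ|_] := boolP (v \in Z); last by exists 0.
  have [|t Ht] := line_param i QB Ql (Zl v vZ); last by exists t.
  by apply: contraNneq QZ => <-.
rewrite -(coef_restr (p_ i) (pt Q) hf).1.
suff -> : restr (p_ i) (pt Q) f = 0 by rewrite coef0.
apply: (@roots_geq_poly_eq0 _ _ [seq t v | v <- enum Z]).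
- apply/allP => _ /mapP[v + ->]; rewrite mem_enum => vZ.
  have [c c0 vE] := Ht v vZ; rewrite /root horner_restr.
  have /eqP := fZ v vZ; rewrite (meval_eq _ vE) (meval_dhomog_scale _ _ hf).
  by rewrite mulf_eq0 expf_eq0 (negbTE c0) andbF.
- rewrite map_inj_in_uniq ?enum_uniq // => u v; rewrite !mem_enum => uZ vZ tuv.
  have [c c0 uE] := Ht u uZ; have [c' c'0 vE] := Ht v vZ.
  have := Zl u uZ; have := Zl v vZ; rewrite !line_pointsP => /andP[nv _] /andP[nu _].
  by apply: normalized_par => // k k'; rewrite !uE !vE tuv; ring.
by rewrite size_map -cardE; apply: leq_trans (size_restr _ _ hf) _.
Qed.

Let dualP w : reflect (supp w \subset B /\ forall c, c \in C -> \sum_(v in B) w v * c v = 0)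
  (w \in Cp).
Proof.
rewrite inE; apply: (iffP andP) => -[wB wC]; split=> //.
  by move=> c cC; have /forallP/(_ c) := wC; rewrite cC => /eqP.
by apply/forallP => c; apply/implyP => cC; rewrite wC.
Qed.

Let dual_comb b w w' : w \in Cp -> w' \in Cp -> w' - b *: w \in Cp.
Proof.
move=> /dualP[/subsetP wB wC] /dualP[/subsetP w'B w'C]; apply/dualP; split.
  apply/subsetP => v; rewrite inE => nz; apply/negPn/negP => vB; case/eqP: nz.
  have w0 (x : {ffun vec3 F -> F^o}) : {subset supp x <= B} -> x v = 0.
    by move=> xB; apply/eqP/negPn/negP => xv; case/negP: vB; apply: xB; rewrite inE.
  by rewrite !ffunE !w0 // scaler0 subr0.
move=> c cC; rewrite (eq_bigr (fun v => w' v * c v - (b : F^o) * (w v * c v))) => [|v _].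
  by rewrite sumrB -mulr_sumr w'C // wC // mulr0 subr0.
by rewrite !ffunE mulrBl -scalerAl.
Qed.

Lemma dual_word_on_line_uniq w w' : w \in Cp -> w' \in Cp ->
  supp w = supp w' -> #|supp w| = (d + 2 - s)%N -> exists2 c : F, c != 0 & w' = c *: w.
Proof.
move=> wC w'C eS cS.
have [Q Qw] : exists Q, Q \in supp w.
  by apply/card_gt0P; rewrite cS; move: (hs) (hsd); clear; lia.
have wQ : w Q != 0 by rewrite inE in Qw.
have w'Q : w' Q != 0 by move: Qw; rewrite eS inE.
(* With this ratio the difference also vanishes at [Q], so its support is too small for a nonzero
   dual word. *)
exists (w' Q / w Q); first by rewrite mulf_neq0 ?invr_eq0.
apply/eqP; rewrite -subr_eq0; apply/negPn/negP => nz.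
have := dual_min_weight (dual_comb (w' Q / w Q) wC w'C) nz; rewrite leqNgt -cS => /negP[].
apply: proper_card; apply/properP; split; last first.
  by exists Q => //; rewrite inE !ffunE negbK -[_ *: _]/(_ * _) divfK // subrr.
apply/subsetP => v; rewrite inE; apply: contraR => vw.
have := vw; rewrite {1}eS !inE !negbK => /eqP w'v; move: vw; rewrite inE negbK => /eqP wv.
by rewrite !ffunE wv w'v scaler0 subr0.
Qed.

Lemma dual_word_on_line (S : {set vec3 F}) : S \subset B :&: line_points l -> #|S| = (d + 2 - s)%N ->
  exists2 w, w \in Cp & supp w = S.
Proof.
move=> /subsetP SBR cS.
have SB v : v \in S -> v \in B by move=> /SBR/setIP[].
have Sl v : v \in S -> v \in line_points l by move=> /SBR/setIP[].
have [Q QS] : exists Q, Q \in S.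
  by apply/card_gt0P; rewrite cS; move: (hs) (hsd); clear; lia.
pose M : 'M[F]_(\dim C, #|S|) := \matrix_(k, j) (vbasis C)`_k (enum_val j).
pose jQ : 'I_(#|S|) := enum_rank_in QS Q.
(* Otherwise some codeword is 1 at [Q] and 0 on the rest of [S]. Its form has d + 1 - s zeros there
   and the s zeros [P i], all on [l], hence vanishes at [Q]. *)
have nsub : ~~ ((delta_mx 0 jQ : 'rV[F]_(#|S|)) <= M)%MS.
  apply/negP => /submxP[x xM].
  pose c := \sum_k x 0 k *: (vbasis C)`_k.
  have cC : c \in C.
    apply: memv_suml => k _; apply: memvZ; apply: vbasis_mem; apply: mem_nth.
    by rewrite size_tuple.
  have cE v : v \in S -> c v = (v == Q)%:R.
    move=> vS; have := congr1 (fun A : 'rV[F]_#|S| => A 0 (enum_rank_in QS v)) xM.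
    have -> : (v == Q) = (enum_rank_in QS v == jQ).
      apply/eqP/eqP => [->//|e].
      by rewrite -(enum_rankK_in QS vS) e enum_rankK_in.
    rewrite !mxE /= => ->; rewrite sum_ffunE; apply: eq_bigr => k _.
    by rewrite !mxE ffunE enum_rankK_in.
  have [f [hf fE cf]] := codeP _ cC.
  have fv v : v \in S -> v != Q -> f.@[pt v] = 0.
    move=> vS vQ; have := cE v vS; rewrite cf ffunE SB // (negbTE vQ).
    have [b b0 -> /eqP] := meval_rep hf (B_X (SB _ vS)).
    by rewrite mulf_eq0 (negbTE b0) => /eqP.
  have fQ : f.@[pt Q] = 0.
    apply: (@line_form_vanish f Q (S :\ Q :|: [set P i | i : 'I_s])) => //.
    - exact: SB.
    - exact: Sl.
    - apply/subsetP => v /setUP[/setD1P[_ /Sl //]|/imsetP[i _ ->]].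
      exact: P_R.
    - rewrite !inE eqxx /=; have := SB _ QS.
      by case/setDP.
    - rewrite cardsU disjoint_setI0 ?cards0 ?subn0; last first.
        rewrite disjoint_subset; apply/subsetP => v /setD1P[_ /SB/setDP[_ vP]].
        by rewrite inE.
      rewrite card_imset // card_ord; move: cS; rewrite (cardsD1 Q) QS.
      by move: #|_| (hs) (hsd) => k; clear; lia.
    - by move=> v /setUP[/setD1P[vQ vS]|/imsetP[i _ ->]]; [apply: fv | apply: on_E_meval].
  have := cE Q QS; rewrite cf ffunE SB // eqxx.
  have [b b0 ->] := meval_rep hf (B_X (SB _ QS)).
  by rewrite fQ mulr0 => /eqP; rewrite eq_sym oner_eq0.
(* A vector outside the row space is not killed by [cokermx M], so some column of that matrix is
   nonzero at [Q]; extended by 0, this column is the dual word. *)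
move: nsub; rewrite submxE => nz.
have [k nzk] : exists k, cokermx M jQ k != 0.
  case: (pickP (fun k => cokermx M jQ k != 0)) => [k nk|z]; first by exists k.
  case/eqP: nz; apply/rowP => k; rewrite -rowE mxE [RHS]mxE.
  by apply/eqP/negPn; rewrite z.
pose w : {ffun vec3 F -> F^o} :=
  [ffun v => if v \in S then cokermx M (enum_rank_in QS v) k else 0].
have wQ : w Q != 0 by rewrite ffunE QS.
have wS : supp w \subset S.
  by apply/subsetP => v; rewrite inE ffunE; case: ifP => //; rewrite eqxx.
have wC : w \in Cp.
  apply/dualP; split; first by apply: subset_trans wS _; apply/subsetP.
  move=> c cC; rewrite (coord_vbasis cC).
  under eq_bigr => v _ do rewrite sum_ffunE mulr_sumr.
  rewrite exchange_big big1 //= => m _.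
  have /matrixP/(_ m k) := mulmx_coker M; rewrite !mxE => E0.
  transitivity (coord (vbasis C) m c * \sum_j M m j * cokermx M j k); last first.
    by rewrite E0 mulr0.
  rewrite mulr_sumr (bigID (mem S)) /= [X in _ + X]big1 => [|v /andP[_ vS]]; last first.
    by rewrite ffunE (negbTE vS) mul0r.
  rewrite addr0 (eq_bigl (mem S)) => [|v]; last first.
    by rewrite /= andbC; case: (boolP (v \in S)) => // /SB ->.
  rewrite big_enum_val /=; apply: eq_bigr => j _.
  rewrite !ffunE enum_valP !mxE enum_valK_in -[_ *: _]/(_ * _).
  by rewrite mulrC -mulrA.
(* The support lies in [S], and the minimum weight forces it to be all of [S]. *)
exists w => //; apply/eqP; rewrite eqEcard wS cS.
by apply: dual_min_weight => //; apply: contra_neq wQ => ->; rewrite ffunE.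
Qed.

(** With c the pairing of [P i] and [P j], the vector P i + t P j is isotropic when y = c t^q
    satisfies y^q + y = 0. This gives q values of t, and [P j] is one more point. *)
Lemma card_secant_curve : (q < #|X :&: line_points l|)%N.
Proof.
pose i := Ordinal (ltnW hs); pose j := Ordinal hs.
have ji : j != i by [].
pose c := '[p_ i, p_ j]; have c0 : c != 0 := PPn ji.
have cji : '[p_ j, p_ i] = c ^+ q by rewrite herm_sym.
pose T := [set (y / c) ^+ q | y in [set y : F | y ^+ q + y == 0]].
have cT : #|T| = q.
  rewrite card_in_imset; first by rewrite trace_fiber // expr0n gtn_eqF // ltnW.
  move=> y z _ _ /(congr1 (fun x => x ^+ q)); rewrite !q2K => /(congr1 (fun x => x * c)).
  by rewrite !divfK.
(* The slope of P i + t P j is t, and that of P j is infinite. *)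
pose slope (v : vec3 F) := let x := '[pt v, p_ j] / c in
  if x == 0 then None else Some ('[pt v, p_ i] / c ^+ q / x).
suff sub : None |: [set Some t | t in T] \subset slope @: (X :&: line_points l).
  have := leq_trans (subset_leq_card sub) (leq_imset_card _ _).
  rewrite cardsU1 card_imset; last by move=> ? ? [].
  by rewrite cT; case: imsetP => // -[].
apply/subsetP => _ /setU1P[->|/imsetP[_ /imsetP[y yT ->] ->]].
  apply/imsetP; exists (P j); first by rewrite inE P_X P_R.
  by rewrite /slope PP mul0r eqxx.
pose t := (y / c) ^+ q; pose w k := 1 * p_ i k + t * p_ j k + 0 * p_ j k.
have wE z : '[w, z] = '[p_ i, z] + t * '[p_ j, z] by rewrite herm_comb; ring.
have wj : '[w, p_ j] = c by rewrite wE PP mulr0 addr0.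
have wi : '[w, p_ i] = t * c ^+ q by rewrite wE PP add0r cji.
have ww : '[w, w] = 0.
  rewrite wE (herm_sym q_gt1 q_char q2K w) wi (herm_sym q_gt1 q_char q2K w) wj.
  rewrite exprMn /t !q2K divfK // expr_div_n divfK ?expf_neq0 //.
  by move: yT; rewrite inE addrC => /eqP.
have [k wk] : exists k, w k != 0.
  case: (pickP (fun k => w k != 0)) => [k wk|w0]; first by exists k.
  have {}w0 k : w k = 0 by apply/eqP/negPn; rewrite w0.
  by case/eqP: c0; rewrite -wj hermE !w0; ring.
have [b [u nu [b0 uE]]] := normalize_exists wk.
have hb z : '[w, z] = b * '[pt u, z] by rewrite !hermE !uE; ring.
have uz z : '[pt u, z] = '[w, z] / b by rewrite hb mulrC mulKf.
apply/imsetP; exists u; last first.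
  rewrite /slope uz wj uz wi -/t mulrAC mulfV // mul1r invr_eq0 (negbTE b0).
  by congr Some; field; rewrite b0 oner_neq0 expf_neq0.
rewrite inE line_pointsP nu lE uz wE !PU mulr0 addr0 mul0r eqxx !andbT.
apply/hermitian_pointsP; split=> //; apply/eqP; move/eqP: ww.
by rewrite (herm_scale q uE) !mulf_eq0 expf_eq0 (negbTE b0) andbF.
Qed.

End HermitianCode.

(** * Combination of the length, the dimension and the description of the minimum-weight dual
    words *)

Theorem theorem4p6 (F : finFieldType) (q : nat)
  (q_pp : exists p k : nat, [/\ prime p, (0 < k)%N & q = (p ^ k)%N])
  (cardF : #|F| = (q ^ 2)%N)
  (s d : nat) (hs : (2 <= s)%N) (hsd : (s <= d.-1)%N) (hdq : (d.-1 <= q - 2)%N)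
  (a : 'I_s -> nat)
  (ha : forall i : 'I_s, (0 < a i <= d + 1 - i.+1)%N)
  (hsum : (\sum_(i < s) a i <= 3 * d - 7 + s)%N)
  (P : 'I_s -> vec3 F) (P_inj : injective P)
  (P_X : forall i, P i \in hermitian_points F q)
  (l : vec3 F) (l_nz : l != 0) (P_R : forall i, P i \in line_points l)
  (rep : vec3 F -> vec3 F)
  (hrep : forall v, v \in hermitian_points F q -> exists2 c : F, c != 0 & rep v = c *: v) :
  let B := hermitian_points F q :\: [set P i | i : 'I_s] in
  let R := line_points l in
  let C := eval_code (hermitian_poly F q) B rep d P a in
  let Cp := dual_code B C in
  #|B| = (q ^ 3 + 1 - s)%N /\
      \dim C = ('C(d + 2, 2) - \sum_(i < s) a i)%N /\
      (exists2 w, w \in Cp & (w != 0) && (weight w == d + 2 - s)%N) /\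
      (forall w, w \in Cp -> w != 0 -> (d + 2 - s <= weight w)%N) /\
      (forall w, w \in Cp ->
         (w != 0 /\ weight w = (d + 2 - s)%N) <->
         (supp w \subset B :&: R /\ #|supp w| = (d + 2 - s)%N)) /\
      (forall S : {set vec3 F}, S \subset B :&: R -> #|S| = (d + 2 - s)%N ->
         exists w, [/\ w \in Cp, supp w = S &
           forall w', w' \in Cp -> supp w' = S -> exists2 c : F, c != 0 & w' = c *: w]).
Proof.
move=> B R C Cp.
have cardB : #|B| = (q ^ 3 + 1 - s)%N.
  rewrite cardsD (card_hermitian_points q_pp cardF) (setIidPr _) ?card_imset ?card_ord //.
  by apply/subsetP => _ /imsetP[i _ ->].
have min_weight w : w \in Cp -> w != 0 -> (d + 2 - s <= weight w)%N.
  exact: (dual_min_weight q_pp cardF hs hsd hdq ha P_inj P_X l_nz P_R hrep).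
have on_R (S : {set vec3 F}) : S \subset B :&: R -> #|S| = (d + 2 - s)%N ->
    exists2 w, w \in Cp & supp w = S.
  exact: (dual_word_on_line q_pp cardF hs hsd hdq ha P_inj P_X l_nz P_R hrep).
have w_neq0 w : #|supp w| = (d + 2 - s)%N -> w != 0 :> {ffun vec3 F -> F^o}.
  move=> cw; apply: contra_eq_neq cw => ->.
  rewrite (_ : supp 0 = set0) ?cards0; last by apply/setP => v; rewrite !inE ffunE eqxx.
  by move: hs hsd; clear; lia.
split=> //; split; first exact: (dim_eval_code q_pp cardF hs hsd hdq ha P_inj P_X l_nz P_R hrep).
split.
  (* The line has at least q + 1 points on the curve; removing the s points [P i] leaves at least d
     + 2 - s because d <= q - 1. *)
  have /card_geqP[vs [uvs svs vsBR]] : (d + 2 - s <= #|B :&: R|)%N.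
    have := card_secant_curve q_pp cardF hs P_inj P_X P_R.
    have -> : B :&: R = (hermitian_points F q :&: R) :\: [set P i | i : 'I_s].
      by rewrite setIDAC.
    have sub : [set P i | i : 'I_s] \subset hermitian_points F q :&: R.
      by apply/subsetP => _ /imsetP[i _ ->]; rewrite inE P_X P_R.
    rewrite cardsD (setIidPr sub) card_imset // card_ord.
    by move: #|_| hs hsd hdq => k; clear; lia.
  have cS : #|[set v in vs]| = (d + 2 - s)%N by rewrite cardsE -svs; apply/card_uniqP.
  have [|w wC wS] := on_R [set v in vs] _ cS.
    by apply/subsetP => v; rewrite inE => /vsBR.
  by exists w => //; rewrite w_neq0 ?wS //= /weight wS cS.
split=> //; split.
  move=> w wC; split=> [[w0 ww]|[_ cw]]; last by split=> //; apply: w_neq0.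
  split=> //; apply/subsetP => v vw.
  have vB : v \in B by move: wC; rewrite inE => /andP[/subsetP wB _]; apply: wB.
  rewrite inE vB inE /=.
  have lv := dual_min_weight_on_line q_pp cardF hs hsd hdq ha P_inj P_X l_nz P_R hrep wC ww vw.
  apply/andP; split; last by apply/eqP; exact: lv.
  by case/setDP: vB; rewrite inE => /andP[].
move=> S SBR cS; have [w wC wS] := on_R S SBR cS; exists w; split=> // w' w'C w'S.
apply: (dual_word_on_line_uniq q_pp cardF hs hsd hdq ha P_inj P_X l_nz P_R hrep wC w'C).
  by rewrite wS w'S.
by rewrite wS.
Qed.
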